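(* $\mathsf{C}_{2^\omega}\star\mathsf{wFindL}_{\bm{\Pi}^0_1}\equiv_{\mathrm W}\mathsf{C}_{\omega^\omega}$, and consequently $\mathsf{wFindL}_{\bm{\Pi}^0_1}\equiv^{\mathrm a}_{\mathrm W}\mathsf{C}_{\omega^\omega}$.
   Context: Weihrauch reducibility: for partial multi-valued functions $f,g$ between represented spaces, a realizer of $g$ is a partial $G$ on $\omega^\omega$ sending each name of each $x\in\mathrm{dom}(g)$ to a name of an element of $g(x)$. $f\leq_{\mathrm W}g$ if there are computable partial $\varphi,\psi$ on $\omega^\omega$ such that for every realizer $G$ of $g$, $p\mapsto\psi(\langle p,G(\varphi(p))\rangle)$ is a realizer of $f$. $f\leq^{\mathrm a}_{\mathrm W}g$ (arithmetical Weihrauch reducibility) is defined in the same way with $\varphi,\psi$ arithmetical instead of computable. $\equiv_{\mathrm W}$, $\equiv^{\mathrm a}_{\mathrm W}$ denote mutual reducibility. The compositional product $f\star g$ is (up to $\equiv_{\mathrm W}$) the $\leq_{\mathrm W}$-greatest problem among $f_0\circ g_0$ with $f_0\leq_{\mathrm W}f$, $g_0\leq_{\mathrm W}g$ (apply $g$, then a computable operation, then $f$). A closed subset of $\omega^\omega$ is named by an enumeration of a set of strings coding its complement as an open set; equivalently by a tree $V\subseteq\omega^{<\omega}$ whose body $[V]$ is the closed set. A Laver tree (always with empty stem) is a prefix-closed $T\subseteq\omega^{<\omega}$ containing $\langle\rangle$ such that every $\sigma\in T$ has infinitely many immediate successors in $T$. $\mathrm{LT}:\omega^\omega\to\{\text{Laver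 trees}\}$ is a total bijective representation of Laver trees, computably equivalent to the representation via characteristic functions. $\mathsf{wFindL}_{\bm{\Pi}^0_1}:\subseteq\bm{\Pi}^0_1(\omega^\omega)\rightrightarrows\omega^\omega$ maps a closed set $A$ to $\{f:[\mathrm{LT}(f)]\subseteq A\}$, with domain the set of closed $A$ such that every Laver tree $T$ satisfies $[T]\cap A\neq\emptyset$. $\mathsf{C}_{\omega^\omega}$ (resp. $\mathsf{C}_{2^\omega}$) maps a tree $T\subseteq\omega^{<\omega}$ (resp. $T\subseteq2^{<\omega}$) with $[T]\neq\emptyset$ to $[T]$, i.e. any path is an admissible output. *)

(* Defs.v *)
From mathcomp Require Import all_boot.
From mathcomp Require Import all_classical.
From mathcomp Require Import topology.

Set Implicit Arguments.
Unset Strict Implicit.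
Unset Printing Implicit Defensive.

Local Open Scope classical_set_scope.

Notation baire := (nat -> nat).

(** * Computability relative to an oracle *)

(* The pairing [a, b] |-> 2 ^ a * (2 * b + 1) - 1 is a bijection; it is the one
   underlying the coding of finite sequences, see [npair_code]. *)
Definition npair (a b : nat) : nat := (2 ^ a * b.*2.+1).-1.
Definition nfst (n : nat) : nat := head 0 (CodeSeq.decode n.+1).
Definition nsnd (n : nat) : nat := CodeSeq.code (behead (CodeSeq.decode n.+1)).

Lemma npair_code a s : (npair a (CodeSeq.code s)).+1 = CodeSeq.code (a :: s).
Proof. by rewrite /npair prednK //= muln_gt0 expn_gt0. Qed.

Lemma nfstK a b : nfst (npair a b) = a.
Proof. by rewrite -(CodeSeq.decodeK b) /nfst npair_code CodeSeq.codeK. Qed.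

Lemma nsndK a b : nsnd (npair a b) = b.
Proof. by rewrite -(CodeSeq.decodeK b) /nsnd npair_code CodeSeq.codeK. Qed.

Lemma npairK n : npair (nfst n) (nsnd n) = n.
Proof.
apply: succn_inj; rewrite npair_code /nfst -[RHS]CodeSeq.decodeK.
by case E: (CodeSeq.decode _) => //; move: (CodeSeq.decodeK n.+1); rewrite E.
Qed.

(* Kleene's partial recursive functions with an oracle, in unary form: several
   arguments are passed as one number through [npair]. *)
Inductive prog : Type :=
| PZero | PSucc | PFst | PSnd | POracle
| PPair of prog & prog
| PComp of prog & prog
| PRec of prog & prog
| PMu of prog.

(* [eval p c n v]: with oracle [p], program [c] halts on [n] with value [v]. *)
Inductive eval (p : baire) : prog -> nat -> nat -> Prop :=
| eval_zero n : eval p PZero n 0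
| eval_succ n : eval p PSucc n n.+1
| eval_fst n : eval p PFst n (nfst n)
| eval_snd n : eval p PSnd n (nsnd n)
| eval_oracle n : eval p POracle n (p n)
| eval_pair c d n a b :
    eval p c n a -> eval p d n b -> eval p (PPair c d) n (npair a b)
| eval_comp c d n m v :
    eval p d n m -> eval p c m v -> eval p (PComp c d) n v
| eval_rec0 c d a v :
    eval p c a v -> eval p (PRec c d) (npair a 0) v
| eval_recS c d a k r v :
    eval p (PRec c d) (npair a k) r ->
    eval p d (npair a (npair k r)) v ->
    eval p (PRec c d) (npair a k.+1) v
| eval_mu c a k :
    eval p c (npair a k) 0 ->
    (forall j, j < k -> exists v, eval p c (npair a j) v.+1) ->
    eval p (PMu c) a k.

(* Relations on Baire space x numbers that are arithmetical, without
   parameters: the closure of the semirecursive ones under complement,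
   intersection and number quantification. *)
Inductive arith_rel : (baire -> nat -> Prop) -> Prop :=
| arith_semirec c : arith_rel (fun p n => exists v, eval p c n v)
| arith_not R : arith_rel R -> arith_rel (fun p n => ~ R p n)
| arith_and R S :
    arith_rel R -> arith_rel S -> arith_rel (fun p n => R p n /\ S p n)
| arith_ex R :
    arith_rel R -> arith_rel (fun p n => exists k, R p (npair n k)).

(** * Partial functions on Baire space *)

Record pfun : Type := PFun {
  graph :> baire -> baire -> Prop;
  graph_fun : forall p q r, graph p q -> graph p r -> q = r }.

(* As usual in computable analysis, a partial function is computable when some
   program computes it on its domain; nothing is asked outside the domain. *)
Definition computable (F : pfun) : Prop :=
  exists c : prog, forall p q, F p q -> forall n, eval p c n (q n).

Definition arithmetical (F : pfun) : Prop :=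
  exists2 R, arith_rel R &
    forall p q, F p q -> forall n m, R p (npair n m) <-> q n = m.

Definition bpair (p q : baire) : baire :=
  fun n => if odd n then q n./2 else p n./2.

(** * Represented spaces, problems, reducibilities *)

(* [names p x]: the representation, a partial surjection from Baire space onto
   the carrier, sends [p] to [x]. *)
Record repspace : Type := RepSpace {
  carrier :> Type;
  names : baire -> carrier -> Prop;
  names_fun : forall p x y, names p x -> names p y -> x = y;
  names_surj : forall x, exists p, names p x }.

(* Partial multi-valued functions; the domain is kept as separate data, so that
   solvability of the instances is not assumed silently. *)
Record problem (X Y : repspace) : Type := Problem {
  dom : set X;
  sol : X -> set Y }.

Arguments Problem : clear implicits.

Definition realizer (X Y : repspace) (g : problem X Y) (G : pfun) : Prop :=
  forall p x, names p x -> dom g x ->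
    exists q y, [/\ G p q, names q y & sol g x y].

(* The partial function p |-> psi (<p, G (phi p)>). *)
Definition transform_graph (phi psi G : pfun) (p r : baire) : Prop :=
  exists p' q, [/\ phi p p', G p' q & psi (bpair p q) r].

Lemma transform_fun phi psi G p r s :
  transform_graph phi psi G p r -> transform_graph phi psi G p s -> r = s.
Proof.
move=> [p1 [q1 [f1 g1 h1]]] [p2 [q2 [f2 g2 h2]]].
have e := graph_fun f1 f2; rewrite -e in g2.
by rewrite -(graph_fun g1 g2) in h2; exact: graph_fun h1 h2.
Qed.

Definition transform (phi psi G : pfun) : pfun :=
  PFun (@transform_fun phi psi G).

Definition reducible (C : pfun -> Prop) (X Y Z W : repspace)
    (f : problem X Y) (g : problem Z W) : Prop :=
  exists phi psi : pfun, [/\ C phi, C psi &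
    forall G, realizer g G -> realizer f (transform phi psi G)].

Notation "f <=W g" := (reducible computable f g)
  (at level 70, no associativity).
Notation "f <=aW g" := (reducible arithmetical f g)
  (at level 70, no associativity).
Notation "f =W g" := (f <=W g /\ g <=W f) (at level 70, no associativity).
Notation "f =aW g" := (f <=aW g /\ g <=aW f) (at level 70, no associativity).

Definition compose (X Y Z : repspace) (f : problem Y Z) (g : problem X Y) :
    problem X Z :=
  Problem X Z [set x | dom g x /\ sol g x `<=` dom f]
    (fun x => [set z | exists2 y, sol g x y & sol f y z]).

(* [h] represents the degree of the compositional product of [f] after [g]:
   up to equivalence, [h] is the greatest of the problems [compose f0 g0] with
   [f0 <=W f] and [g0 <=W g]. *)
Definition is_comp_product (X Y Z W S T : repspace)
    (f : problem X Y) (g : problem Z W) (h : problem S T) : Prop :=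
  (exists (A B C : repspace) (f0 : problem B C) (g0 : problem A B),
      [/\ f0 <=W f, g0 <=W g & h =W compose f0 g0]) /\
  (forall (A B C : repspace) (f0 : problem B C) (g0 : problem A B),
      f0 <=W f -> g0 <=W g -> compose f0 g0 <=W h).

(** * Baire space, trees and closed sets as represented spaces *)

Lemma baire_names_fun (p x y : baire) : p = x -> p = y -> x = y.
Proof. by move=> -> ->. Qed.

Lemma baire_names_surj (x : baire) : exists p, p = x.
Proof. by exists x. Qed.

Definition baire_space : repspace :=
  RepSpace baire_names_fun baire_names_surj.

Definition is_tree (T : set (seq nat)) : Prop :=
  forall s t, prefix s t -> T t -> T s.

Definition body (T : set (seq nat)) : set baire :=
  [set x | forall n, T (mkseq x n)].

(* [p] is the characteristic function of [T]; [CodeSeq.code] is a bijection from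
   [seq nat] to [nat]. *)
Definition charfun (p : baire) (T : set (seq nat)) : Prop :=
  forall s, p (CodeSeq.code s) = `[< T s >].

Lemma charfun_fun p T U : charfun p T -> charfun p U -> T = U.
Proof.
move=> pT pU; apply/funext => s; apply/propext.
by have := pT s; rewrite pU; case: asboolP; case: asboolP.
Qed.

Lemma charfun_surj T : exists p, charfun p T.
Proof.
exists (fun n => `[< T (CodeSeq.decode n) >] : nat) => s.
by rewrite CodeSeq.codeK.
Qed.

Lemma sval_inj (X : Type) (P : X -> Prop) : injective (@sval X P).
Proof. by move=> [x Px] [y Py] /= xy; subst y; congr exist; exact: Prop_irrelevance. Qed.

Definition tree : Type := {T : set (seq nat) | is_tree T}.
Definition tree_names (p : baire) (T : tree) : Prop := charfun p (sval T).

Lemma tree_names_fun p (T U : tree) :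
  tree_names p T -> tree_names p U -> T = U.
Proof. by move=> pT pU; exact/sval_inj/(charfun_fun pT pU). Qed.

Lemma tree_names_surj (T : tree) : exists p, tree_names p T.
Proof. exact: charfun_surj. Qed.

Definition tree_space : repspace := RepSpace tree_names_fun tree_names_surj.

(* [p] enumerates the strings of code [p n - 1] (with [p n = 0] enumerating
   nothing); [closed_of p] is the complement of the open set they generate. *)
Definition closed_of (p : baire) : set baire :=
  [set x | forall n k, p n <> (CodeSeq.code (mkseq x k)).+1].

Lemma near_mkseq (x : baire) k :
  nbhs (x : {ptws nat -> nat}) [set y : baire | mkseq y k = mkseq x k].
Proof.
elim: k => [|k IHk]; first exact: filterE.
have nk : nbhs (x : {ptws nat -> nat}) [set y : baire | y k = x k].
  apply: (@proj_continuous nat (fun=> nat) k x [set m | m = x k]).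
  exact/principal_filterP.
apply: filterS (filterI IHk nk) => y [/= yk yk1].
by rewrite !mkseqS yk yk1.
Qed.

Lemma closed_closed_of p : closed (closed_of p : set {ptws nat -> nat}).
Proof.
move=> x clx n k pnk; have [y [Ay /= yx]] := clx _ (near_mkseq x k).
by apply: (Ay n k); rewrite yx.
Qed.

Lemma closed_mkseq (A : set {ptws nat -> nat}) (x : baire) : closed A ->
  (forall k, exists2 y : baire, A y & mkseq y k = mkseq x k) -> A x.
Proof.
move=> clA /(_ _)/cid2-/all_sig2[y Ay yx].
have cy : (y : nat -> {ptws nat -> nat}) @ \oo --> (x : {ptws nat -> nat}).
  apply/pointwise_cvgP => i; apply: cvg_near_cst; exists i.+1 => // k /= ik.
  by rewrite -(nth_mkseq 0 x ik) -yx nth_mkseq.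
by apply: (closed_cvg _ clA _ _ cy); exact: filterE.
Qed.

Definition closed_subset : Type :=
  {A : set baire | closed (A : set {ptws nat -> nat})}.
Definition closed_names (p : baire) (A : closed_subset) : Prop :=
  sval A = closed_of p.

Lemma closed_names_fun p (A B : closed_subset) :
  closed_names p A -> closed_names p B -> A = B.
Proof. by move=> pA pB; apply: sval_inj; rewrite pA. Qed.

Lemma closed_names_surj (A : closed_subset) : exists p, closed_names p A.
Proof.
pose disj s := forall y, sval A y -> mkseq y (size s) <> s.
exists (fun n => if `[< disj (CodeSeq.decode n) >] then n.+1 else 0).
apply/seteqP; split=> [x Ax n k|x nx].
  case: asboolP => //= dn [en]; apply: (dn x Ax).
  by rewrite en CodeSeq.codeK size_mkseq.
apply: (closed_mkseq (svalP A)) => k; apply: contrapT => nex.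
have dk : disj (mkseq x k).
  by move=> y Ay; rewrite size_mkseq => yx; apply: nex; exists y.
apply: (nx (CodeSeq.code (mkseq x k)) k).
by rewrite CodeSeq.codeK; case: asboolP.
Qed.

Definition closed_space : repspace :=
  RepSpace closed_names_fun closed_names_surj.

(** * Choice problems *)

Definition C_baire : problem tree_space baire_space :=
  Problem tree_space baire_space
    (fun T : tree_space => body (sval T) !=set0)
    (fun T => body (sval T)).

(* Binary strings are the sequences of numbers less than 2. *)
Definition is_binary (T : set (seq nat)) : Prop :=
  forall s, T s -> all (fun i => i < 2) s.

Definition C_cantor : problem tree_space baire_space :=
  Problem tree_space baire_space
    (fun T : tree_space => is_binary (sval T) /\ body (sval T) !=set0)
    (fun T => body (sval T)).

(** * Laver trees *)

Definition laver_tree (T : set (seq nat)) : Prop :=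
  [/\ is_tree T, T [::] &
      forall s, T s -> infinite_set [set n | T (rcons s n)]].

(* [F] translates names in the first system into names in the second. *)
Definition computably_translates (X : Type) (d d' : baire -> X -> Prop) : Prop :=
  exists2 F : pfun, computable F &
    forall p x, d p x -> exists2 q, F p q & d' q x.

Definition laver_representation (LT : baire -> set (seq nat)) : Prop :=
  [/\ set_bij [set: baire] laver_tree LT,
      computably_translates (fun p T => LT p = T)
                            (fun p T => laver_tree T /\ charfun p T) &
      computably_translates (fun p T => laver_tree T /\ charfun p T)
                            (fun p T => LT p = T)].

Definition wFindL (LT : baire -> set (seq nat)) :
    problem closed_space baire_space :=
  Problem closed_space baire_space
    (fun A : closed_space =>
      forall T, laver_tree T -> body T `&` sval A !=set0)
    (fun A => [set f | body (LT f) `<=` sval A]).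

(* Main.v *)
(* Choice on Baire space computes a path through any set that is Pi^0_1 in the
   instance, and this makes it closed under composition.  For a name [p] of a
   closed set [A], "[T] is a Laver tree containing no string enumerated by [p]"
   is such a condition on [T] together with witnesses for its infinite branching;
   it is satisfiable because otherwise the player choosing infinitely many
   successors at each turn forces the play out of [A], along a Laver tree.
   Conversely, given a tree [T] with a path, let [A] be the set of [x] that bound a
   path of [T] pointwise.  By compactness [A] is Pi^0_1 in [T], and it meets every
   Laver tree since these have branches dominating any given function.  A branch of
   a Laver tree with body inside [A] is an [x] below which [T] has a path; such a
   path is found by choice on Cantor space, and the leftmost one is
   arithmetical in [T] and [x]. *)

Require Import Defs.
From mathcomp Require Import all_boot.
From mathcomp Require Import all_classical.
From mathcomp Require Import zify.

Set Implicit Arguments.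
Unset Strict Implicit.
Unset Printing Implicit Defensive.

(** Reducibility quantifies over whole realizers, while composing and bounding problems is a matter
    of single instances and single answers. The two views agree when the target is solvable, so the
    solvability of [wFindL] enters the maximality half of the compositional product. The obstacle to
    composing choice problems is that the second instance is computed from the answer to the first:
    for a wrong answer that computation may diverge. Pi^0_1 conditions are therefore given by
    programs that may diverge, where only a nonzero output is an objection. For the lower bound a
    concrete factorization is used. Its intermediate point carries a name of the tree along with the
    bound, because the second problem receives only that point. *)

Local Notation code := CodeSeq.code.
Local Notation decode := CodeSeq.decode.

(** * Finite approximation of computations *)

(* The value is [v.+1] if [c] halts on [n] with value [v] using the finite oracle
   [s], and [0] otherwise; [size s] also bounds the search in [PMu]. *)
Fixpoint run (s : seq nat) (c : prog) (n : nat) : nat :=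
  match c with
  | PZero => 1
  | PSucc => n.+2
  | PFst => (nfst n).+1
  | PSnd => (nsnd n).+1
  | POracle => if n < size s then (nth 0 s n).+1 else 0
  | PPair c d =>
      if (run s c n == 0) || (run s d n == 0) then 0
      else (npair (run s c n).-1 (run s d n).-1).+1
  | PComp c d => if run s d n == 0 then 0 else run s c (run s d n).-1
  | PRec c d =>
      nat_rect (fun=> nat) (run s c (nfst n))
        (fun k r => if r == 0 then 0
                    else run s d (npair (nfst n) (npair k r.-1)))
        (nsnd n)
  | PMu c =>
      let k := find (fun j => run s c (npair n j) <= 1) (iota 0 (size s)) in
      if (k < size s) && (run s c (npair n k) == 1) then k.+1 else 0
  end.

Lemma find_iota_eq (a : pred nat) m k :
  k < m -> a k -> (forall j, j < k -> ~~ a j) -> find a (iota 0 m) = k.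
Proof.
move=> km ak aj; have fk : ~~ (k < find a (iota 0 m)).
  apply/negP => kf; have := before_find 0 kf.
  by rewrite nth_iota // add0n ak.
have hm : has a (iota 0 m) by apply/hasP; exists k; rewrite // mem_iota.
have := nth_find 0 hm; have := hm; rewrite has_find size_iota => fm.
rewrite nth_iota // add0n => af; apply/eqP; rewrite eqn_leq leqNgt fk /=.
by rewrite leqNgt; apply/negP => /aj; rewrite af.
Qed.

Lemma run_mono s t c n v : size s <= size t ->
  (forall i, i < size s -> nth 0 s i = nth 0 t i) ->
  run s c n = v.+1 -> run t c n = v.+1.
Proof.
move=> st nst; elim: c n v => //= [|c IHc d IHd|c IHc d IHd|c IHc d IHd|c IHc] n v.
- case: ltnP => // ns; rewrite (leq_trans ns st) => <-; congr S.
  by rewrite nst.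
- case E: (run s c n) => [|a] //; case F: (run s d n) => [|b] //=.
  by rewrite (IHc _ _ E) (IHd _ _ F).
- by case F: (run s d n) => [|b] //=; rewrite (IHd _ _ F) /=; exact: IHc.
- elim: (nsnd n) v => [|k IHk] v /=; first exact: IHc.
  case E: (nat_rect _ _ _ k) => [|r] //=; rewrite (IHk _ E) /=; exact: IHd.
(* The test [<= 1] also stops at an undetermined value. All indices below [k] thus have definite
   nonzero values under [s]; these persist under [t], where the search stops at [k] again. *)
- set k := find _ _; case: ifP => // /andP[ks /eqP rk] [<-].
  have hm : find (fun j => run t c (npair n j) <= 1) (iota 0 (size t)) = k.
    apply: find_iota_eq; first exact: leq_trans ks st.
      by rewrite (IHc _ _ rk).
    move=> j jk; have := before_find 0 jk.
    rewrite nth_iota ?add0n; last exact: ltn_trans jk ks.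
    by case E: (run s c _) => [|[|w]] //; rewrite (IHc _ _ E).
  by rewrite hm (leq_trans ks st) /= (IHc _ _ rk).
Qed.

Lemma run_mkseq_mono (p : baire) c n v k l : k <= l ->
  run (mkseq p k) c n = v.+1 -> run (mkseq p l) c n = v.+1.
Proof.
move=> kl; apply: run_mono; rewrite !size_mkseq // => i ik.
by rewrite !nth_mkseq //; exact: leq_trans ik kl.
Qed.

Lemma run_eval p c n v k : run (mkseq p k) c n = v.+1 -> eval p c n v.
Proof.
elim: c n v => //= [|||||c IHc d IHd|c IHc d IHd|c IHc d IHd|c IHc] n v.
- by move=> [<-]; exact: eval_zero.
- by move=> [<-]; exact: eval_succ.
- by move=> [<-]; exact: eval_fst.
- by move=> [<-]; exact: eval_snd.
- rewrite size_mkseq; case: ltnP => // nk [<-]; rewrite nth_mkseq //.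
  exact: eval_oracle.
- case E: (run _ c n) => [|a] //; case F: (run _ d n) => [|b] //= [<-].
  by apply: eval_pair; [exact: IHc|exact: IHd].
- case F: (run _ d n) => [|b] //= E.
  by apply: eval_comp; [exact: IHd F|exact: IHc E].
- rewrite -[X in eval _ _ X](npairK n).
  elim: (nsnd n) v => [|j IHj] v /=; first by move=> E; apply: eval_rec0; exact: IHc.
  case E: (nat_rect _ _ _ j) => [|r] //= F.
  by apply: eval_recS; [exact: IHj E|exact: IHd F].
- set j := find _ _; case: ifP => // /andP[js /eqP rj] [<-].
  apply: eval_mu => [|i ij]; first exact: IHc.
  have := before_find 0 ij.
  rewrite nth_iota ?add0n; last exact: ltn_trans ij js.
  by case E: (run _ c _) => [|[|w]] // _; exists w; exact: IHc.
Qed.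


(** The rules for [PRec] have pairs as indices; splitting the argument by its projections avoids
    equations between pairs at each inversion. *)
Lemma eval_inv p c n v : eval p c n v ->
  match c with
  | PZero => v = 0
  | PSucc => v = n.+1
  | PFst => v = nfst n
  | PSnd => v = nsnd n
  | POracle => v = p n
  | PPair c d => exists a b, [/\ eval p c n a, eval p d n b & v = npair a b]
  | PComp c d => exists2 m, eval p d n m & eval p c m v
  | PRec c d =>
      if nsnd n is k.+1 then
        exists2 r, eval p (PRec c d) (npair (nfst n) k) r &
                   eval p d (npair (nfst n) (npair k r)) v
      else eval p c (nfst n) v
  | PMu c => eval p c (npair n v) 0 /\
      forall j, j < v -> exists w, eval p c (npair n j) w.+1
  end.
Proof.
case=> //= {c n v}.
- by move=> c d n a b ca db; exists a, b.
- by move=> c d n m v dm cv; exists m.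
- by move=> c d a v cv; rewrite nfstK nsndK.
- by move=> c d a k r v dr cv; rewrite nfstK nsndK; exists r.
Qed.

(* By induction on the program: the induction principle of [eval] gives no
   hypothesis for the premises of [eval_mu] that are under [exists]. *)
Lemma eval_run p c n v : eval p c n v ->
  exists k, run (mkseq p k) c n = v.+1.
Proof.
elim: c n v => [|||||c IHc d IHd|c IHc d IHd|c IHc d IHd|c IHc] n v /eval_inv.
- by move=> ->; exists 0.
- by move=> ->; exists 0.
- by move=> ->; exists 0.
- by move=> ->; exists 0.
- by move=> ->; exists n.+1; rewrite /run size_mkseq ltnSn nth_mkseq.
- move=> [a [b [/IHc[k1 E1] /IHd[k2 E2] ->]]].
  exists (maxn k1 k2) => /=.
  by rewrite (run_mkseq_mono (leq_maxl _ _) E1) (run_mkseq_mono (leq_maxr _ _) E2).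
- move=> [m /IHd[k1 E1] /IHc[k2 E2]]; exists (maxn k1 k2) => /=.
  rewrite (run_mkseq_mono (leq_maxl _ _) E1) /=.
  by rewrite (run_mkseq_mono (leq_maxr _ _) E2).
- move=> H; have {H} : eval p (PRec c d) n v.
    rewrite -(npairK n); case: (nsnd n) H => [|k]; first exact: eval_rec0.
    by move=> [r]; exact: eval_recS.
  rewrite -(npairK n); move: (nfst n) (nsnd n) => {n} a k.
  elim: k v => [|j IHj] v /eval_inv; rewrite nfstK nsndK.
    by move=> /IHc[k E]; exists k; rewrite /= nfstK nsndK.
  move=> [r /IHj[k1]]; rewrite /= nfstK nsndK => E1 /IHd[k2 E2].
  exists (maxn k1 k2); rewrite nfstK nsndK /=.
  have := @run_mkseq_mono p (PRec c d) (npair a j) r _ _ (leq_maxl k1 k2).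
  rewrite /= nfstK nsndK => -> //=.
  by rewrite (run_mkseq_mono (leq_maxr _ _) E2).
- move=> [/IHc[k0 E0] H].
  have {}H : exists k, forall j, j < v ->
      exists w, run (mkseq p k) c (npair n j) = w.+2.
    elim: v H {E0} => [|v IHv] H; first by exists 0.
    have [j jv|k kP] := IHv; first by apply: H; exact: ltnW.
    have [w /IHc[l El]] := H v (ltnSn v).
    exists (maxn k l) => j; rewrite ltnS leq_eqVlt => /predU1P[->|/kP[u Eu]].
      by exists w; rewrite (run_mkseq_mono (leq_maxr _ _) El).
    by exists u; rewrite (run_mkseq_mono (leq_maxl _ _) Eu).
  (* The prefix must also be longer than [v], since its length bounds the search. *)
  have [k kP] := H; pose l := maxn v.+1 (maxn k0 k).
  have lv : v < l by exact: leq_maxl.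
  have lk0 : k0 <= l by rewrite !leq_max leqnn orbT.
  have lk : k <= l by rewrite !leq_max leqnn !orbT.
  exists l; have := run_mkseq_mono lk0 E0 => {}E0.
  have hf : find (fun j => run (mkseq p l) c (npair n j) <= 1)
                 (iota 0 (size (mkseq p l))) = v.
    apply: find_iota_eq; rewrite ?size_mkseq ?E0 // => j /kP[w Ew].
    by rewrite (run_mkseq_mono lk Ew).
  by rewrite [LHS]/= hf size_mkseq lv E0.
Qed.

Lemma eval_det p c n v w : eval p c n v -> eval p c n w -> v = w.
Proof.
move=> /eval_run[k Ek] /eval_run[l El].
have := run_mkseq_mono (leq_maxl k l) Ek.
by rewrite (run_mkseq_mono (leq_maxr k l) El) => -[].
Qed.

(** * Replacing the oracle by a program *)

Fixpoint subst (d c : prog) : prog :=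
  match c with
  | PZero => PZero
  | PSucc => PSucc
  | PFst => PFst
  | PSnd => PSnd
  | POracle => d
  | PPair a b => PPair (subst d a) (subst d b)
  | PComp a b => PComp (subst d a) (subst d b)
  | PRec a b => PRec (subst d a) (subst d b)
  | PMu a => PMu (subst d a)
  end.

Definition computes (c : prog) (p q : baire) : Prop :=
  forall n, eval p c n (q n).

Lemma eval_subst d c p q n v :
  computes d p q -> eval p (subst d c) n v <-> eval q c n v.
Proof.
move=> dpq.
elim: c n v => [|||||a IHa b IHb|a IHa b IHb|a IHa b IHb|a IHa] n v /=.
- by split=> /eval_inv->; exact: eval_zero.
- by split=> /eval_inv->; exact: eval_succ.
- by split=> /eval_inv->; exact: eval_fst.
- by split=> /eval_inv->; exact: eval_snd.
- split=> [/(eval_det (dpq n))<-|/eval_inv->]; [exact: eval_oracle|exact: dpq].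
- split=> /eval_inv[x [y [/IHa ax /IHb ay ->]]]; exact: eval_pair.
- split=> /eval_inv[x /IHb ax /IHa ay]; exact: eval_comp ax ay.
- rewrite -(npairK n); elim: (nsnd n) v => [|k IHk] v.
    by split=> /eval_inv; rewrite nfstK nsndK => /IHa; exact: eval_rec0.
  split=> /eval_inv; rewrite nfstK nsndK => -[r /IHk kr /IHb bv];
  exact: eval_recS kr bv.
- split=> /eval_inv[/IHa a0 aj]; apply: eval_mu => // j /aj[w /IHa aw];
  by exists w.
Qed.

(** * Uniform computability *)

(* One program computes [f i] from the oracle [o i] for all [i].  Functions of
   several variables are presented through [nfst] and [nsnd]; partial functionals
   are covered by letting [I] range over the points of a graph. *)
Definition urec (I : Type) (o : I -> baire) (f : I -> nat -> nat) : Prop :=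
  exists c, forall i, computes c (o i) (f i).

Section URec.
Variables (I : Type) (o : I -> baire).
Local Notation urec := (urec o).

Lemma urec_oracle : urec o.
Proof. by exists POracle => i n; exact: eval_oracle. Qed.

Lemma urec_id : urec (fun _ n => n).
Proof.
exists (PPair PFst PSnd) => i n; rewrite -{2}(npairK n).
by apply: eval_pair; [exact: eval_fst|exact: eval_snd].
Qed.

Lemma urec_comp f g : urec f -> urec g -> urec (fun i n => f i (g i n)).
Proof.
by move=> [c cf] [d dg]; exists (PComp c d) => i n; exact: eval_comp (dg _ _) (cf _ _).
Qed.

Lemma urec_succ f : urec f -> urec (fun i n => (f i n).+1).
Proof. by apply: (@urec_comp (fun _ n => n.+1)); exists PSucc => i n; exact: eval_succ. Qed.

Lemma urec_fst f : urec f -> urec (fun i n => nfst (f i n)).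
Proof. by apply: (@urec_comp (fun _ => nfst)); exists PFst => i n; exact: eval_fst. Qed.

Lemma urec_snd f : urec f -> urec (fun i n => nsnd (f i n)).
Proof. by apply: (@urec_comp (fun _ => nsnd)); exists PSnd => i n; exact: eval_snd. Qed.

Lemma urec_const k : urec (fun _ _ => k).
Proof.
elim: k => [|k]; last exact: urec_succ.
by exists PZero => i n; exact: eval_zero.
Qed.

Lemma urec_pair f g : urec f -> urec g -> urec (fun i n => npair (f i n) (g i n)).
Proof.
by move=> [c cf] [d dg]; exists (PPair c d) => i n; apply: eval_pair; [exact: cf|exact: dg].
Qed.

Lemma urec_natrec f g h : urec f ->
    urec (fun i x => g i (nfst x) (nfst (nsnd x)) (nsnd (nsnd x))) -> urec h ->
  urec (fun i n => nat_rect (fun=> nat) (f i n) (g i n) (h i n)).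
Proof.
move=> [c cf] [d dg] hh.
suff H : urec (fun i x => nat_rect (fun=> nat) (f i (nfst x)) (g i (nfst x)) (nsnd x)).
  have := urec_comp H (urec_pair urec_id hh).
  by move=> [e eP]; exists e => i n; have := eP i n; rewrite nfstK nsndK.
exists (PRec c d) => i x; rewrite -{1}(npairK x).
elim: (nsnd x) => [|k IHk] /=; first by apply: eval_rec0; exact: cf.
apply: eval_recS IHk _; set r := nat_rect _ _ _ _.
by have := dg i (npair (nfst x) (npair k r)); rewrite !(nfstK, nsndK).
Qed.

Lemma urec_mu (g : I -> nat -> nat -> nat) f :
    urec (fun i x => g i (nfst x) (nsnd x)) ->
    (forall i n, g i n (f i n) = 0) ->
    (forall i n j, j < f i n -> g i n j <> 0) ->
  urec f.
Proof.
move=> [c cg] f0 fj; exists (PMu c) => i n; apply: eval_mu => [|j jf].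
  by rewrite -(f0 i n); have := cg i (npair n (f i n)); rewrite nfstK nsndK.
exists (g i n j).-1; rewrite prednK ?lt0n; last exact/eqP/fj.
by have := cg i (npair n j); rewrite nfstK nsndK.
Qed.

End URec.

Section UrecArith.
Variables (I : Type) (o : I -> baire).
Local Notation urec := (urec o).
Implicit Types f g h : I -> nat -> nat.
Implicit Types a b : I -> nat -> bool.

Lemma urec_ext f g : (forall i n, f i n = g i n) -> urec f -> urec g.
Proof. by move=> fg [c cf]; exists c => i n; rewrite -fg; exact: cf. Qed.

Lemma urec_pred f : urec f -> urec (fun i n => (f i n).-1).
Proof.
move=> hf; apply: (@urec_ext (fun i n => nat_rect (fun=> nat) 0 (fun k _ => k) (f i n))).
  by move=> i n; case: (f i n).
apply: (@urec_natrec _ _ (fun _ _ => 0) (fun _ _ k _ => k)) hf; first exact: urec_const.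
by apply/urec_fst/urec_snd/urec_id.
Qed.

Lemma urec_sub f g : urec f -> urec g -> urec (fun i n => f i n - g i n).
Proof.
move=> hf hg; apply: (@urec_ext (fun i n => nat_rect (fun=> nat) (f i n) (fun _ r => r.-1) (g i n))).
  by move=> i n; elim: (g i n) => [|k IHk] /=; rewrite ?subn0 // IHk subnS.
apply: (@urec_natrec _ _ _ (fun _ _ _ r => r.-1)) => //.
by apply/urec_pred/urec_snd/urec_snd/urec_id.
Qed.

Lemma urec_add f g : urec f -> urec g -> urec (fun i n => f i n + g i n).
Proof.
move=> hf hg; apply: (@urec_ext (fun i n => nat_rect (fun=> nat) (f i n) (fun _ r => r.+1) (g i n))).
  by move=> i n; elim: (g i n) => [|k IHk] /=; rewrite ?addn0 // IHk addnS.
apply: (@urec_natrec _ _ _ (fun _ _ _ r => r.+1)) => //.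
by apply/urec_succ/urec_snd/urec_snd/urec_id.
Qed.

Lemma urec_if b f g : urec (fun i n => b i n) -> urec f -> urec g ->
  urec (fun i n => if b i n then f i n else g i n).
Proof.
move=> hb hf hg.
apply: (@urec_ext (fun i n => nat_rect (fun=> nat) (g i n) (fun _ _ => f i n) (b i n))).
  by move=> i n; case: (b i n).
apply: (@urec_natrec _ _ _ (fun i n _ _ => f i n)) => //.
by apply: urec_comp => //; apply/urec_fst/urec_id.
Qed.

Lemma urec_not b : urec (fun i n => b i n) -> urec (fun i n => ~~ b i n).
Proof.
move=> hb; apply: (@urec_ext (fun i n => 1 - b i n)) => [i n|]; first by case: (b i n).
by apply: urec_sub => //; exact: urec_const.
Qed.

Lemma urec_and a b : urec (fun i n => a i n) -> urec (fun i n => b i n) ->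
  urec (fun i n => a i n && b i n).
Proof.
move=> ha hb; apply: (@urec_ext (fun i n => if a i n then b i n : nat else 0)).
  by move=> i n; case: (a i n).
by apply: urec_if => //; exact: urec_const.
Qed.

Lemma urec_or a b : urec (fun i n => a i n) -> urec (fun i n => b i n) ->
  urec (fun i n => a i n || b i n).
Proof.
move=> ha hb; apply: (@urec_ext (fun i n => if a i n then 1 else b i n)).
  by move=> i n; case: (a i n).
by apply: urec_if => //; exact: urec_const.
Qed.

Lemma urec_leq f g : urec f -> urec g -> urec (fun i n => f i n <= g i n).
Proof.
move=> hf hg; apply: (@urec_ext (fun i n => 1 - (f i n - g i n))) => [i n|].
  by rewrite /leq; case: (f i n - g i n).
by apply: urec_sub; [exact: urec_const|exact: urec_sub].
Qed.

Lemma urec_eq f g : urec f -> urec g -> urec (fun i n => f i n == g i n).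
Proof.
move=> hf hg; apply: (@urec_ext (fun i n => (f i n <= g i n) && (g i n <= f i n))).
  by move=> i n; rewrite eqn_leq.
by apply: urec_and; exact: urec_leq.
Qed.

Lemma urec_find (b : I -> nat -> nat -> bool) h :
    urec (fun i x => b i (nfst x) (nsnd x)) -> urec h ->
  urec (fun i n => find (b i n) (iota 0 (h i n))).
Proof.
(* After [k] steps the state is the first hit below [k], or [k] if there is none; so [r < k] means
   that the search is over. *)
move=> hb hh; pose step i n k r := if r < k then r else if b i n k then k else k.+1.
apply: (@urec_ext (fun i n => nat_rect (fun=> nat) 0 (step i n) (h i n))).
  move=> i n; elim: (h i n) => // k IHk; rewrite [LHS]/= IHk /step.
  rewrite -[in iota 0 k.+1]addn1 iotaD add0n.
  by rewrite find_cat has_find size_iota; case: ifP => //= _; case: ifP; rewrite ?addn0 ?addn1.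
apply: urec_natrec => //; first exact: urec_const; rewrite /step.
have hk : urec (fun _ x => nfst (nsnd x)) by apply/urec_fst/urec_snd/urec_id.
have hr : urec (fun _ x => nsnd (nsnd x)) by apply/urec_snd/urec_snd/urec_id.
apply: urec_if => //; first by apply: urec_leq => //; exact: urec_succ.
apply: urec_if => //; last exact: urec_succ.
have := urec_comp hb (urec_pair (urec_fst (urec_id o)) hk).
by apply: urec_ext => i n; rewrite nfstK nsndK.
Qed.

Lemma urec_has (b : I -> nat -> nat -> bool) h :
    urec (fun i x => b i (nfst x) (nsnd x)) -> urec h ->
  urec (fun i n => has (b i n) (iota 0 (h i n))).
Proof.
move=> hb hh; apply: (@urec_ext (fun i n => find (b i n) (iota 0 (h i n)) < h i n)).
  by move=> i n; rewrite has_find size_iota.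
by apply: urec_leq => //; apply: urec_succ; exact: urec_find.
Qed.

Lemma urec_all (b : I -> nat -> nat -> bool) h :
    urec (fun i x => b i (nfst x) (nsnd x)) -> urec h ->
  urec (fun i n => all (b i n) (iota 0 (h i n))).
Proof.
move=> hb hh; apply: (@urec_ext (fun i n => ~~ has (fun k => ~~ b i n k) (iota 0 (h i n)))).
  by move=> i n; rewrite has_predC negbK.
by apply/urec_not/urec_has => //; exact: urec_not.
Qed.

Lemma urec_half f : urec f -> urec (fun i n => (f i n)./2).
Proof.
move=> hf; apply: (@urec_ext (fun i n => find (fun k => f i n <= k + k.+1) (iota 0 (f i n).+1))).
  move=> i n; apply: find_iota_eq => [||j]; lia.
apply: urec_find; last exact: urec_succ.
apply: urec_leq; first by apply: urec_comp => //; apply/urec_fst/urec_id.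
by apply: urec_add; rewrite -/addn; [|apply: urec_succ]; apply/urec_snd/urec_id.
Qed.

Lemma urec_odd f : urec f -> urec (fun i n => odd (f i n)).
Proof.
move=> hf; apply: (@urec_ext (fun i n => f i n - ((f i n)./2 + (f i n)./2))).
  by move=> i n; rewrite addnn -{1}(odd_double_half (f i n)) addnK.
by apply: urec_sub => //; apply: urec_add; exact: urec_half.
Qed.

Lemma urec_double f : urec f -> urec (fun i n => (f i n).*2).
Proof.
move=> hf; apply: (@urec_ext (fun i n => f i n + f i n)); last exact: urec_add.
by move=> i n; rewrite addnn.
Qed.

Lemma urec_bpair f g : urec f -> urec g -> urec (fun i => bpair (f i) (g i)).
Proof.
move=> hf hg; apply: urec_if; first exact/urec_odd/urec_id.
  by apply: urec_comp => //; exact/urec_half/urec_id.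
by apply: urec_comp => //; exact/urec_half/urec_id.
Qed.

Lemma urec_bpair_l f g : urec (fun i => bpair (f i) (g i)) -> urec f.
Proof.
move=> h; have := urec_comp h (urec_double (urec_id o)).
by apply: urec_ext => i n; rewrite /bpair odd_double doubleK.
Qed.

Lemma urec_bpair_r f g : urec (fun i => bpair (f i) (g i)) -> urec g.
Proof.
move=> h; have := urec_comp h (urec_succ (urec_double (urec_id o))).
by apply: urec_ext => i n; rewrite /bpair /= odd_double uphalf_double.
Qed.

(** * Operations on codes of finite sequences *)

Definition behead_code (n : nat) : nat := nsnd n.-1.

(** Iterating past the end is harmless: the empty sequence has code [0], and [npair 0 0 = 0] makes
    [0] a fixed point of [behead_code]. *)
Lemma code_drop s k : iter k behead_code (code s) = code (drop k s).
Proof.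
elim: k s => [|k IHk] s; first by rewrite drop0.
rewrite iterSr; case: s => [|a s]; last by rewrite -npair_code /behead_code nsndK IHk.
suff -> : behead_code (code [::]) = code [::] by rewrite IHk.
exact: (nsndK 0 0).
Qed.

Lemma urec_iter_behead f g : urec f -> urec g ->
  urec (fun i n => iter (g i n) behead_code (f i n)).
Proof.
move=> hf hg; apply: (@urec_ext (fun i n => nat_rect (fun=> nat) (f i n) (fun _ => behead_code) (g i n))) => //.
apply: (@urec_natrec _ _ _ (fun _ _ _ => behead_code)) => //.
by apply/urec_snd/urec_pred/urec_snd/urec_snd/urec_id.
Qed.

Lemma urec_nth f g : urec f -> urec g -> urec (fun i n => nth 0 (decode (f i n)) (g i n)).
Proof.
move=> hf hg; apply: (@urec_ext (fun i n => nfst (iter (g i n) behead_code (f i n)).-1)).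
  move=> i n; rewrite -{1}(CodeSeq.decodeK (f i n)) code_drop -[RHS]addn0 -[X in nth _ _ X]addn0.
  rewrite -nth_drop addn0; case: (drop _ _) => [|a s]; last by rewrite -npair_code nfstK.
  exact: (nfstK 0 0).
by apply/urec_fst/urec_pred/urec_iter_behead.
Qed.

Lemma code_eq0 s : (code s == 0) = nilp s.
Proof. by case: s => [|a s]; rewrite // -npair_code. Qed.

Lemma leq_size_code s : size s <= code s.
Proof.
elim: s => //= a s IHs; have : 0 < 2 ^ a by rewrite expn_gt0.
by nia.
Qed.

Lemma urec_size f : urec f -> urec (fun i n => size (decode (f i n))).
Proof.
move=> hf; apply: (@urec_ext (fun i n =>
    find (fun k => iter k behead_code (f i n) == 0) (iota 0 (f i n).+1))).
  move=> i n; rewrite -{1 2}(CodeSeq.decodeK (f i n)); apply: find_iota_eq => [||j].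
  - by rewrite ltnS leq_size_code.
  - by rewrite code_drop drop_size.
  - by rewrite code_drop code_eq0 /nilp size_drop subn_eq0 -ltnNge.
apply: urec_find; last exact: urec_succ.
apply: urec_eq; last exact: urec_const.
apply: urec_iter_behead; last exact/urec_snd/urec_id.
by apply: urec_comp => //; exact/urec_fst/urec_id.
Qed.

Lemma urec_mkseq (F : I -> nat -> nat -> nat) h :
    urec (fun i x => F i (nfst x) (nsnd x)) -> urec h ->
  urec (fun i n => code (mkseq (F i n) (h i n))).
Proof.
(* Codes grow at the front, so the sequence is built backwards: after [k] steps the state codes its
   last [k] entries. *)
move=> hF hh; pose step i n k r := (npair (F i n (h i n - k.+1)) r).+1.
apply: (@urec_ext (fun i n => nat_rect (fun=> nat) 0 (step i n) (h i n))).
  move=> i n; suff H k : k <= h i n -> nat_rect (fun=> nat) 0 (step i n) k =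
      code (map (F i n) (iota (h i n - k) k)) by rewrite H // subnn.
  elim: k => //= k IHk kh; rewrite IHk 1?ltnW // /step npair_code.
  by rewrite (_ : (h i n - k.+1).+1 = h i n - k) // subnSK.
apply: urec_natrec => //; first exact: urec_const; rewrite /step.
apply/urec_succ/urec_pair; last by apply/urec_snd/urec_snd/urec_id.
pose m i x := npair (nfst x) (h i (nfst x) - (nfst (nsnd x)).+1).
apply: (@urec_ext (fun i x => F i (nfst (m i x)) (nsnd (m i x)))).
  by move=> i n; rewrite nfstK nsndK.
apply: (urec_comp hF); apply: urec_pair; first exact/urec_fst/urec_id.
apply: urec_sub; first by apply: urec_comp => //; apply/urec_fst/urec_id.
by apply/urec_succ/urec_fst/urec_snd/urec_id.
Qed.

End UrecArith.

Ltac urec_head :=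
  lazymatch goal with
  | |- urec _ (fun _ _ => ?k) => exact: urec_const
  | |- urec _ (fun _ n => n) => exact: urec_id
  | |- urec _ (fun _ => bpair _ _) => apply: urec_bpair
  | |- urec _ (fun i n => S _) => apply: urec_succ
  | |- urec _ (fun i n => predn _) => apply: urec_pred
  | |- urec _ (fun i n => addn _ _) => apply: urec_add
  | |- urec _ (fun i n => subn _ _) => apply: urec_sub
  | |- urec _ (fun i n => double _) => apply: urec_double
  | |- urec _ (fun i n => half _) => apply: urec_half
  | |- urec _ (fun i n => npair _ _) => apply: urec_pair
  | |- urec _ (fun i n => nfst _) => apply: urec_fst
  | |- urec _ (fun i n => nsnd _) => apply: urec_snd
  | |- urec _ (fun i n => nth 0 (decode _) _) => apply: urec_nth
  | |- urec _ (fun i n => size (decode _)) => apply: urec_size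
  | |- urec _ (fun i n => code (mkseq _ _)) => apply: urec_mkseq
  | |- urec _ (fun i n => find _ (iota 0 _)) => apply: urec_find
  | |- urec _ (fun i n => nat_of_bool (has _ (iota 0 _))) => apply: urec_has
  | |- urec _ (fun i n => nat_of_bool (all _ (iota 0 _))) => apply: urec_all
  | |- urec _ (fun i n => nat_of_bool (_ == _)) => apply: urec_eq
  | |- urec _ (fun i n => nat_of_bool (_ <= _)) => apply: urec_leq
  | |- urec _ (fun i n => nat_of_bool (~~ _)) => apply: urec_not
  | |- urec _ (fun i n => nat_of_bool (_ && _)) => apply: urec_and
  | |- urec _ (fun i n => nat_of_bool (_ || _)) => apply: urec_or
  | |- urec _ (fun i n => nat_of_bool (odd _)) => apply: urec_odd
  | |- urec _ (fun i n => if _ then _ else _) => apply: urec_if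
  | |- urec _ (fun i n => nat_rect _ _ _ _) => apply: urec_natrec
  end.

Ltac urec_tac :=
  cbv beta;
  first [ eassumption | exact: urec_oracle
        | progress urec_head; urec_tac
        | match goal with H : urec _ _ |- _ =>
            apply: (urec_comp H); urec_tac end
        | idtac ].

(** The simulating program is assembled by induction on [c], which stays fixed while the oracle
    prefix and the argument vary. *)
Lemma urec_run (I : Type) (o : I -> baire) c f g : urec o f -> urec o g ->
  urec o (fun i n => run (decode (f i n)) c (g i n)).
Proof.
move=> hf hg.
suff [d dP] : urec o (fun _ x => run (decode (nfst x)) c (nsnd x)).
  have := urec_comp (ex_intro _ d dP) (urec_pair hf hg).
  by apply: urec_ext => i n; rewrite nfstK nsndK.
have lift e h k : urec o (fun _ x => run (decode (nfst x)) e (nsnd x)) ->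
    urec o h -> urec o k -> urec o (fun i n => run (decode (h i n)) e (k i n)).
  move=> he hh hk; have := urec_comp he (urec_pair hh hk).
  by apply: urec_ext => i n; rewrite nfstK nsndK.
elim: c => [|||||c IHc d IHd|c IHc d IHd|c IHc d IHd|c IHc] /=; urec_tac.
all: by do 3?[apply: (lift _ _ _); urec_tac].
Qed.

Lemma all_iotaP (a : pred nat) n : reflect (forall k, k < n -> a k) (all a (iota 0 n)).
Proof.
apply: (iffP allP) => [H k kn|H k]; first by apply: H; rewrite mem_iota.
by rewrite mem_iota => /H.
Qed.

Lemma has_iotaP (a : pred nat) n :
  reflect (exists2 k, k < n & a k) (has a (iota 0 n)).
Proof.
apply: (iffP hasP) => -[k]; first by rewrite mem_iota => kn ak; exists k.
by move=> kn ak; exists k; rewrite // mem_iota.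
Qed.

(** * Pi^0_1 sets as bodies of computable trees *)

Lemma half_ltn i k : i < k -> i./2 < k.
Proof. lia. Qed.

(* Two programs are needed because the divergence of one must not hide a nonzero
   value of the other. *)
Lemma body_tree_computable (c d : prog) : exists e, forall p,
  exists (t : baire) (T : tree), [/\ computes e p t, tree_names t T &
    body (sval T) = [set z | forall n v,
      (eval (bpair p z) c n v -> v = 0) /\ (eval (bpair p z) d n v -> v = 0)]%classic].
Proof.
pose ok p s k n := let r := decode (code (mkseq (bpair p (nth 0 s)) k)) in
  (run r c n <= 1) && (run r d n <= 1).
(* The first [k] entries of the joined oracle use only entries of [s] below [k]. Testing every stage
   up to the length of [s] makes closure under prefixes immediate. *)
pose inT p s :=
  all (fun k => all (ok p s k) (iota 0 k)) (iota 0 (size s).+1).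
have hid : urec id (fun p : baire => p) by exact: urec_oracle.
have [e eP] : urec id (fun p j => inT p (decode j)).
  rewrite /inT /ok; urec_tac.
  1-2: by apply: urec_run; urec_tac; rewrite /bpair; urec_tac.
have okP p z k n : ok p (mkseq z k) k n =
    (run (mkseq (bpair p z) k) c n <= 1) && (run (mkseq (bpair p z) k) d n <= 1).
  rewrite /ok CodeSeq.codeK; suff -> : mkseq (bpair p (nth 0 (mkseq z k))) k =
    mkseq (bpair p z) k by [].
  apply/eq_in_map => i; rewrite mem_iota add0n /bpair => /= ik.
  by case: ifP => // _; rewrite nth_mkseq // half_ltn.
have ok_prefix p s t k n : prefix s t -> k <= size s -> ok p s k n = ok p t k n.
  move=> /prefixP[u ->] ks; rewrite /ok.
  suff -> : mkseq (bpair p (nth 0 s)) k = mkseq (bpair p (nth 0 (s ++ u))) k by [].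
  apply/eq_in_map => i; rewrite mem_iota add0n /bpair => /= ik.
  by case: ifP => // _; rewrite nth_cat ifT // (leq_trans _ ks) // half_ltn.
exists e => p; exists (fun j => inT p (decode j)).
have treeT : is_tree (fun s => inT p s).
  move=> s t st /= /all_iotaP Tt; apply/all_iotaP => k ks.
  apply/all_iotaP => n nk; rewrite (ok_prefix _ _ _ _ _ st) //.
  apply: (all_iotaP _ _ (Tt k _)) => //.
  by apply: leq_trans ks _; rewrite ltnS size_prefix.
exists (exist _ _ treeT); split => //.
  by move=> s; rewrite /= CodeSeq.codeK asboolb.
apply/seteqP; split=> z /= Tz.
  have Tk k n : n < k -> (run (mkseq (bpair p z) k) c n <= 1) &&
      (run (mkseq (bpair p z) k) d n <= 1).
    move=> nk; rewrite -okP; apply: all_iotaP nk.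
    apply: (all_iotaP _ _ (Tz k)); by rewrite size_mkseq.
  move=> n v; split => /eval_run[k Ek]; have /andP[] := Tk (maxn k n.+1) n (leq_maxr _ _);
    by rewrite (run_mkseq_mono (leq_maxl _ _) Ek) //; case: v {Ek}.
move=> k; apply/all_iotaP => l; rewrite size_mkseq ltnS => lk.
apply/all_iotaP => n nl.
have pre : prefix (mkseq z l) (mkseq z k).
  apply/prefixP; exists (map z (iota l (k - l))).
  by rewrite -map_cat -{2}(add0n l) -iotaD subnKC.
rewrite -(ok_prefix _ _ _ _ _ pre) ?size_mkseq // okP.
by apply/andP; split; case E: (run _ _ _) => [|[|v]] //; have [H1 H2] := Tz n v.+1;
  [have := H1 (run_eval E)|have := H2 (run_eval E)].
Qed.

Local Open Scope classical_set_scope.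

(** * Reducibility by programs *)

Lemma computes_fun c p q r : computes c p q -> computes c p r -> q = r.
Proof. by move=> cq cr; apply/funext => n; exact: eval_det (cq n) (cr n). Qed.

Definition prog_fun (c : prog) : pfun := PFun (@computes_fun c).

Lemma computable_prog_fun c : computable (prog_fun c).
Proof. by exists c. Qed.

Lemma computes_subst a c o p q :
  computes a o p -> computes c p q -> computes (subst a c) o q.
Proof. by move=> ao cp n; apply/eval_subst. Qed.

Lemma computes_bpair a b : exists e, forall o p q,
  computes a o p -> computes b o q -> computes e o (bpair p q).
Proof.
pose I := {x : baire * (baire * baire) | computes a x.1 x.2.1 /\ computes b x.1 x.2.2}.
have ha : urec (fun i : I => (sval i).1) (fun i => (sval i).2.1).
  by exists a => i; case: (svalP i).
have hb : urec (fun i : I => (sval i).1) (fun i => (sval i).2.2).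
  by exists b => i; case: (svalP i).
have [e eP] := urec_bpair ha hb; exists e => o p q ao bo.
exact: (eP (exist _ (o, (p, q)) (conj ao bo))).
Qed.

Lemma computes_bpair_l : exists e, forall p q, computes e (bpair p q) p.
Proof.
have [e eP] := urec_bpair_l (urec_oracle (fun x : baire * baire => bpair x.1 x.2)).
by exists e => p q; exact: (eP (p, q)).
Qed.

Lemma computes_bpair_r : exists e, forall p q, computes e (bpair p q) q.
Proof.
have [e eP] := urec_bpair_r (urec_oracle (fun x : baire * baire => bpair x.1 x.2)).
by exists e => p q; exact: (eP (p, q)).
Qed.

Lemma bpair_surj z : exists p q, z = bpair p q.
Proof.
exists (fun n => z n.*2), (fun n => z n.*2.+1); apply/funext => n; rewrite /bpair.
by have := odd_double_half n; case: (odd n) => <-; rewrite ?add0n ?add1n /= ?uphalf_double ?doubleK.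
Qed.

(** Being a path, put in the form of a Pi^0_1 condition: a nonzero value at [n] is the objection
    that the prefix of length [n] has left the tree. *)
Definition off_tree (t s : baire) : baire := fun n => t (code (mkseq s n)) != 1.

Lemma computes_off_tree a b : exists e, forall o t s,
  computes a o t -> computes b o s -> computes e o (off_tree t s).
Proof.
pose I := {x : baire * (baire * baire) | computes a x.1 x.2.1 /\ computes b x.1 x.2.2}.
have ha : urec (fun i : I => (sval i).1) (fun i => (sval i).2.1).
  by exists a => i; case: (svalP i).
have hb : urec (fun i : I => (sval i).1) (fun i => (sval i).2.2).
  by exists b => i; case: (svalP i).
have [e eP] : urec (fun i : I => (sval i).1) (fun i => off_tree (sval i).2.1 (sval i).2.2).
  by rewrite /off_tree; urec_tac.
exists e => o t s ao bo; exact: (eP (exist _ (o, (t, s)) (conj ao bo))).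
Qed.

Lemma off_treeP t T s : charfun t T -> body T s <-> forall n, off_tree t s n = 0.
Proof.
move=> tT; rewrite /off_tree; split=> H n.
  by rewrite tT; case: asboolP (H n).
by have := H n; rewrite tT; case: asboolP.
Qed.

Lemma computes_zeroP c o f : computes c o f ->
  (forall n v, eval o c n v -> v = 0) <-> forall n, f n = 0.
Proof.
move=> cf; split=> [H n|H n v /(eval_det (cf n))<-//].
exact: H (cf n).
Qed.

(** Reducibility without realizers: the instance of [g] depends on [p] alone, and [d] has to cope
    with every name of every solution. *)
Definition wred (X Y Z W : repspace) (f : problem X Y) (g : problem Z W) : Prop :=
  exists c d : prog, forall p x, names p x -> dom f x ->
    exists p' z, [/\ computes c p p', names p' z, dom g z &
      forall q w, names q w -> sol g z w ->
        exists r y, [/\ computes d (bpair p q) r, names r y & sol f x y]].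

Definition solvable (X Y : repspace) (f : problem X Y) : Prop :=
  forall x, dom f x -> sol f x !=set0.

Lemma wred_reducible (X Y Z W : repspace) (f : problem X Y) (g : problem Z W) :
  wred f g -> f <=W g.
Proof.
move=> [c [d cd]]; exists (prog_fun c), (prog_fun d).
split; try exact: computable_prog_fun.
move=> G Gg p x px fx; have [p' [z [cp p'z gz H]]] := cd p x px fx.
have [q [w [Gq qw zw]]] := Gg _ _ p'z gz.
have [r [y [dr ry xy]]] := H _ _ qw zw.
by exists r, y; split=> //; exists p', q.
Qed.

(* Solvability of [g] matters: without a realizer of [g] the reducibility is void. *)
Lemma reducible_wred (X Y Z W : repspace) (f : problem X Y) (g : problem Z W) :
  solvable g -> f <=W g -> wred f g.
Proof.
move=> gsol [phi [psi [[c phic] [d psid] H]]].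
pose inst p := exists2 z : Z, names p z & dom g z.
pose ans p q := forall z : Z, names p z -> dom g z ->
  exists2 w : W, names q w & sol g z w.
have ans_ex p : exists q, ans p q.
  have [[z pz gz]|np] := pselect (inst p).
    have [w zw] := gsol _ gz; have [q qw] := names_surj w.
    by exists q => z' pz' _; rewrite -(names_fun pz pz'); exists w.
  by exists p => z pz gz; case: np; exists z.
have [h hP] := choice ans_ex.
(* These realizers are defined only at names of instances and answer [b] at [a]. Being defined at
   the image of [p] under [phi] shows that this image names an instance; varying [b] confronts [psi]
   with every admissible answer. *)
have real a b : ans a b -> exists G : pfun, realizer g G /\
    forall p q, G p q -> inst p /\ (p = a -> q = b).
  move=> ab; pose k p := if pselect (p = a) is left _ then b else h p.
  have kf p q r : inst p /\ q = k p -> inst p /\ r = k p -> q = r.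
    by move=> [_ ->] [_ ->].
  exists (PFun kf); split=> [p z pz gz|p q [ip ->]].
    have : ans p (k p) by rewrite /k; case: pselect => [->|].
    move=> /(_ z pz gz)[w kw zw]; exists (k p), w; split=> //.
    by split=> //; exists z.
  by split=> // ->; rewrite /k; case: pselect.
exists c, d => p x px fx.
have [G [/H/(_ p x px fx)[r [y [[p' [q [phip Gq psir]]] ry xy]]] GP]] := real p _ (hP p).
have [[z p'z gz] _] := GP _ _ Gq.
exists p', z; split=> // [|q' w q'w zw]; first exact: phic.
have a' : ans p' q' by move=> z' p'z' _; rewrite -(names_fun p'z p'z'); exists w.
have [G' [/H/(_ p x px fx)[r' [y' [[p2 [q2 [phip2 Gq2 psir2]]] ry' xy']]] GP']] :=
  real _ _ a'.
have [_ /(_ (graph_fun phip2 phip)) e] := GP' _ _ Gq2; subst q2.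
by exists r', y'; split=> //; exact: psid.
Qed.

Lemma computes_id : exists e, forall p, computes e p p.
Proof. by have [e eP] := urec_oracle (fun p : baire => p); exists e. Qed.

Lemma wred_refl (X Y : repspace) (f : problem X Y) : wred f f.
Proof.
have [e eP] := computes_bpair_r; have [i iP] := computes_id.
exists i, e => p x px fx; exists p, x; split=> // q w qw xw.
by exists q, w.
Qed.

Lemma wred_trans (X Y Z W U V : repspace) (f : problem X Y) (g : problem Z W)
  (h : problem U V) : wred f g -> wred g h -> wred f h.
Proof.
move=> [c1 [d1 H1]] [c2 [d2 H2]].
have [pl plP] := computes_bpair_l; have [pr prP] := computes_bpair_r.
have [b bP] := computes_bpair (subst pl c1) pr.
have [b' b'P] := computes_bpair pl (subst b d2).
exists (subst c1 c2), (subst b' d1) => p x px fx.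
have [p' [z [cp p'z gz {}H1]]] := H1 p x px fx.
have [p2 [u [cp' p2u hu {}H2]]] := H2 p' z p'z gz.
exists p2, u; split=> // [|q v qv uv]; first exact: computes_subst cp'.
have [q' [w [dq' q'w zw]]] := H2 _ _ qv uv.
have [r [y [dr ry xy]]] := H1 _ _ q'w zw.
exists r, y; split=> //; apply: computes_subst dr; apply: b'P => //.
by apply: computes_subst dq'; apply: bP => //; exact: computes_subst cp.
Qed.

(** The paths of the combined tree are the pairs of a path [q] for the instance of [g] and a path
    [s] for the instance of [f] computed from [q]. If [q] is not a path, the test on [s] may diverge
    and raise no objection, but the separate test on [q] already rejects the pair. *)
Lemma wred_compose_C_baire (A B C : repspace) (f : problem B C) (g : problem A B) :
  wred f C_baire -> wred g C_baire -> wred (compose f g) C_baire.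
Proof.
move=> [cf [df F]] [cg [dg G]].
have [pl plP] := computes_bpair_l; have [pr prP] := computes_bpair_r.
have [bq bqP] := computes_bpair pl (subst pr pl).
have qP p q s : computes bq (bpair p (bpair q s)) (bpair p q).
  by apply: bqP => //; apply: computes_subst.
have [k1 k1P] := computes_off_tree (subst pl cg) (subst pr pl).
have [k2 k2P] := computes_off_tree (subst (subst bq dg) cf) (subst pr pr).
have [bo boP] := computes_bpair (subst bq dg) (subst pr pr).
have [e eP] := body_tree_computable k1 k2.
exists e, (subst bo df) => p x px [gx gf].
have [t1 [T1 [ct1 tT1 /= [q0 Tq0] H1]]] := G _ _ px gx.
have [t [T [et tT bT]]] := eP p.
have H2 q : body (sval T1) q -> exists r1 y1 t2 (T2 : tree),
  [/\ computes dg (bpair p q) r1, sol g x y1, computes cf r1 t2, tree_names t2 T2 &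
   body (sval T2) !=set0 /\ forall s, body (sval T2) s -> exists r z,
     [/\ computes df (bpair r1 s) r, names r z & sol f y1 z]].
  move=> Tq; have [r1 [y1 [cr1 r1y1 xy1]]] := H1 q _ erefl Tq.
  have [t2 [T2 [ct2 tT2 T2n {}H2]]] := F _ _ r1y1 (gf _ xy1).
  exists r1, y1, t2, T2; split=> //; split=> // s T2s.
  by have [r [z ?]] := H2 s _ erefl T2s; exists r, z.
have k1P' q s : computes k1 (bpair p (bpair q s)) (off_tree t1 q).
  by apply: k1P; exact: computes_subst.
have k2P' q s r1 t2 : computes dg (bpair p q) r1 -> computes cf r1 t2 ->
    computes k2 (bpair p (bpair q s)) (off_tree t2 s).
  move=> cr1 ct2; apply: k2P; last exact: computes_subst.
  by apply: computes_subst ct2; exact: computes_subst cr1.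
exists t, T; split=> // [|_ z -> ].
  have [r1 [y1 [t2 [T2 [cr1 _ ct2 tT2 [[s0 Ts0] _]]]]]] := H2 _ Tq0.
  exists (bpair q0 s0); rewrite bT => n v; split; move: n v.
    by apply/(computes_zeroP (k1P' _ _))/(off_treeP _ tT1).
  by apply/(computes_zeroP (k2P' _ _ _ _ cr1 ct2))/(off_treeP _ tT2).
rewrite /= bT; have [q [s ->]] := bpair_surj z => zP.
(* Only once [q] is known to be a path is the second test known to be total. *)
have Tq : body (sval T1) q.
  apply/(off_treeP _ tT1)/(computes_zeroP (k1P' _ s)) => n v.
  by have [] := zP n v.
have [r1 [y1 [t2 [T2 [cr1 xy1 ct2 tT2 [_ {}H2]]]]]] := H2 _ Tq.
have Ts : body (sval T2) s.
  apply/(off_treeP _ tT2)/(computes_zeroP (k2P' _ _ _ _ cr1 ct2)) => n v.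
  by have [] := zP n v.
have [r [w [dr rw yw]]] := H2 _ Ts.
exists r, w; split=> //; last by exists y1.
apply: computes_subst dr; apply: boP; last exact: computes_subst.
exact: computes_subst cr1.
Qed.

Lemma C_cantor_C_baire : wred C_cantor C_baire.
Proof.
have [e eP] := computes_bpair_r; have [i iP] := computes_id.
exists i, e => p T pT [_ fT]; exists p, T; split=> // q w -> Tw.
by exists w, w.
Qed.

Lemma solvable_C_cantor : solvable C_cantor.
Proof. by move=> T []. Qed.

(** * Laver trees *)

Section Branch.
Variables (s : seq nat) (f : seq nat -> nat).

Definition stage (k : nat) : seq nat := iter k (fun t => rcons t (f t)) s.

Definition branch : baire :=
  fun i => if i < size s then nth 0 s i else f (stage (i - size s)).

Lemma mkseq_branch k : mkseq branch (size s + k) = stage k.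
Proof.
elim: k => [|k IHk]; last first.
  by rewrite addnS mkseqS IHk /branch ltnNge leq_addr /= addKn.
rewrite addn0 -[RHS](mkseq_nth 0); apply/eq_in_map => i.
by rewrite mem_iota /branch => /= ->.
Qed.

Lemma branch_ge k : size s <= k -> branch k = f (mkseq branch k).
Proof.
by move=> sk; rewrite -(subnKC sk) mkseq_branch /branch ltnNge leq_addr /= addKn.
Qed.

Lemma body_branch T : is_tree T -> T s -> (forall t, T t -> T (rcons t (f t))) ->
  body T branch.
Proof.
move=> Ttree Ts Tf k.
have Tk : T (stage k) by elim: k => //= k; exact: Tf.
apply: Ttree Tk; rewrite -mkseq_branch; apply/prefixP.
exists (map branch (iota k (size s + k - k))).
by rewrite -map_cat -{2}(add0n k) -iotaD subnKC // leq_addl.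
Qed.

Lemma mkseq_branch_size : mkseq branch (size s) = s.
Proof. by rewrite -[size s]addn0 mkseq_branch. Qed.

End Branch.

Lemma infinite_set_geq (N : set nat) :
  infinite_set N <-> forall m, exists2 n, m <= n & N n.
Proof.
split=> [Ninf m|Nm /finite_seqP[s Ns]].
  apply: contrapT => H; apply: Ninf.
  apply: sub_finite_set (finite_II m) => n Nn /=.
  by rewrite ltnNge; apply/negP => mn; apply: H; exists n.
have [n sn] := Nm (\max_(i <- s) i).+1; rewrite Ns /= => ns.
by have := leq_trans sn (leq_bigmax_seq (F:=fun i => i) n ns isT); rewrite ltnn.
Qed.

(** Infinite branching always offers a successor above the value demanded by [g]; only the entries
    already fixed by [s] escape the bound. *)
Lemma laver_branch T s (g : baire) : laver_tree T -> T s ->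
  exists x, [/\ body T x, mkseq x (size s) = s & forall k, size s <= k -> g k <= x k].
Proof.
move=> [Ttree _ Tinf] Ts.
have /choice[f fP] t : exists n, T t -> g (size t) <= n /\ T (rcons t n).
  have [Tt|nTt] := pselect (T t); last by exists 0.
  by have [n gn Tn] := (infinite_set_geq _).1 (Tinf t Tt) (g (size t)); exists n.
have bT : body T (branch s f) by apply: body_branch => // t /fP[].
exists (branch s f); split=> // [|k sk]; first exact: mkseq_branch_size.
rewrite branch_ge //; have [] := fP _ (bT k).
by rewrite size_mkseq.
Qed.

(** * The game of forcing a play into an open set *)

Lemma mkseqSl (T : Type) (x : nat -> T) k : mkseq x k.+1 = x 0 :: mkseq (x \o S) k.
Proof. by rewrite /mkseq /= -[iota 1 k]/(iota (1 + 0) k) iotaDl -map_comp. Qed.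

(* The strings from which the player choosing infinitely many successors at
   each turn can force the play to enter [U]. *)
Inductive forces (U : set (seq nat)) : seq nat -> Prop :=
| forces_now s : U s -> forces U s
| forces_next s (N : set nat) : infinite_set N ->
    (forall n, N n -> forces U (rcons s n)) -> forces U s.

(** The strategy is unfolded into a tree of continuations of [s]: the trees of the successors in [N]
    are grafted under a new root. Once [U] is entered the full tree is appended, as a Laver tree
    must go on branching. *)
Lemma forces_laver U s : forces U s -> exists T, laver_tree T /\
  forall x, body T x -> exists k, U (s ++ mkseq x k).
Proof.
elim=> {s} [s Us|s N Ninf _ IH].
  exists setT; split; last by move=> x _; exists 0; rewrite cats0.
  by split=> // t _; exact: infinite_nat.
have /choice[T TP] n : exists T, N n -> laver_tree T /\
    forall x, body T x -> exists k, U (rcons s n ++ mkseq x k).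
  have [/IH[T ?]|nN] := pselect (N n); first by exists T.
  by exists set0.
exists (fun t => if t is n :: t' then N n /\ T n t' else True); split.
  split=> [||[|n t]].
  - move=> [//|m t] [//|n t'] /=.
    case: eqP => //= -> tt' [Nn Tt']; split=> //.
    by have [[Ttree _ _] _] := TP n Nn; exact: Ttree tt' Tt'.
  - by [].
  - move=> _; apply: sub_infinite_set Ninf => n Nn /=; split=> //.
    by have [[]] := TP n Nn.
  - move=> [Nn Tt] /=; have [[_ _ Tinf] _] := TP n Nn.
    by apply: sub_infinite_set (Tinf _ Tt) => m /=.
move=> x Tx; have N0 : N (x 0) by have [] := Tx 1.
have [_ /(_ (x \o S))[k|k Uk]] := TP _ N0.
  by have := Tx k.+1; rewrite mkseqSl => -[].
exists k.+1; suff -> : s ++ mkseq x k.+1 = rcons s (x 0) ++ mkseq (x \o S) k by [].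
by rewrite cat_rcons mkseqSl.
Qed.

Lemma prefix_rconsW (T : eqType) (t s : seq T) n :
  prefix t (rcons s n) -> t = rcons s n \/ prefix t s.
Proof.
move=> /prefixP[u]; case/lastP: u => [|u m]; first by rewrite cats0; left.
by rewrite -rcons_cat => /rcons_inj[-> _]; right; exact: prefix_prefix.
Qed.

(** If only finitely many successors of [s] were not forcing, infinitely many would be, and [s]
    itself would be forcing. So the strings with no forcing prefix branch infinitely. *)
Lemma not_forces_laver U : ~ forces U [::] ->
  exists T, laver_tree T /\ forall s, T s -> ~ U s.
Proof.
move=> nf; exists (fun s => forall t, prefix t s -> ~ forces U t).
split=> [|s Ts Us]; last by apply: (Ts s); [exact: prefix_refl|exact: forces_now].
split=> [s t st Tt u us|t|s Ts].
- exact/Tt/(prefix_trans us).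
- by rewrite prefixs0 => /eqP->.
- suff : infinite_set [set n | ~ forces U (rcons s n)].
    apply: sub_infinite_set => n nfn t.
    by move=> /prefix_rconsW[->//|]; exact: Ts.
  move=> fin; apply: (Ts s); first exact: prefix_refl.
  apply: (@forces_next _ _ [set n | forces U (rcons s n)]) => //.
  move=> fin'; apply: infinite_nat.
  apply: (@sub_finite_set _ _ ([set n | ~ forces U (rcons s n)] `|`
                             [set n | forces U (rcons s n)])).
    by move=> n _ /=; have [] := pselect (forces U (rcons s n)); [right|left].
  by rewrite finite_setU.
Qed.

Lemma laver_dichotomy p : (forall T, laver_tree T -> body T `&` closed_of p !=set0) ->
  exists2 T, laver_tree T & forall s n, T s -> p n <> (code s).+1.
Proof.
move=> meet; have [/forces_laver[T [lT TU]]|] := pselect (forces [set s | exists n, p n = (code s).+1] [::]).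
  have [x [Tx px]] := meet T lT; have [k [n pn]] := TU x Tx.
  by case: (px n k).
move=> /not_forces_laver[T [lT TU]]; exists T => // s n Ts pn.
by apply: (TU s Ts); exists n.
Qed.

(** Every node of a Laver tree lies on a branch, so an enumerated node would put a branch outside
    the closed set. *)
Lemma body_sub_closed_of T p : laver_tree T ->
  body T `<=` closed_of p <-> forall s n, T s -> p n <> (code s).+1.
Proof.
move=> lT; split=> [Tp s n Ts pn|H x Tx n k]; last exact: H.
have [x [/Tp/(_ n (size s)) + xs _]] := laver_branch (fun=> 0) lT Ts.
by rewrite xs.
Qed.

(** * Laver trees as solutions of a Pi^0_1 condition *)

Lemma prefix_mkseq_nth (s t : seq nat) : prefix s t -> mkseq (nth 0 t) (size s) = s.
Proof.
move=> /prefixP[u ->]; rewrite -[RHS](mkseq_nth 0); apply/eq_in_map => i.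
by rewrite mem_iota nth_cat => /= ->.
Qed.

Lemma urec_rcons (I : Type) (o : I -> baire) f g : urec o f -> urec o g ->
  urec o (fun i n => code (rcons (decode (f i n)) (g i n))).
Proof.
move=> hf hg; apply: (@urec_ext _ _ (fun i n => code (mkseq (fun l =>
    if l < size (decode (f i n)) then nth 0 (decode (f i n)) l else g i n)
    (size (decode (f i n))).+1))); last by urec_tac.
move=> i n; congr code; rewrite mkseqS ltnn; congr rcons.
rewrite -[RHS](mkseq_nth 0); apply/eq_in_map => l.
by rewrite mem_iota => /= ->.
Qed.

Lemma pi01_tree (b : baire -> baire -> nat -> bool) :
    urec (fun x : baire * baire => bpair x.1 x.2) (fun x n => b x.1 x.2 n) ->
  exists e, forall p, exists (t : baire) (T : tree),
    [/\ computes e p t, tree_names t T & body (sval T) = [set z | forall n, b p z n]].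
Proof.
(* [PZero] as the second test never objects. *)
move=> /urec_not[c cP]; have [e eP] := body_tree_computable c PZero.
exists e => p; have [t [T [et tT bT]]] := eP p; exists t, T; split=> //.
rewrite bT; apply/seteqP; split=> z /= H n.
  have [/(_ (cP (p, z) n)) + _] := H n (~~ b p z n).
  by case: (b p z n).
move=> v; split=> [cv|/eval_inv//].
by rewrite -(eval_det (cP (p, z) n) cv) H.
Qed.

Lemma pi01_binary_tree (b : baire -> baire -> nat -> bool) :
    urec (fun x : baire * baire => bpair x.1 x.2) (fun x n => b x.1 x.2 n) ->
  exists e, forall p, exists (t : baire) (T : tree),
    [/\ computes e p t, tree_names t T, is_binary (sval T) &
        body (sval T) = [set z | forall n, z n < 2 /\ b p z n]].
Proof.
move=> /pi01_tree[c cP].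
pose bin j := all (fun i => nth 0 (decode j) i < 2) (iota 0 (size (decode j))).
have binP s : bin (code s) = all (fun i => i < 2) s.
  rewrite /bin CodeSeq.codeK; apply/all_iotaP/allP => [H i /(nthP 0)[k ks <-]|H k ks].
    exact: H.
  by apply: H; exact: mem_nth.
have [d dP] : urec (fun t : baire => t) (fun t j => (t j == 1) && bin j).
  have ht := urec_oracle (fun t : baire => t); rewrite /bin; urec_tac.
exists (subst c d) => p; have [t [[T Ttree] /= [ct tT bT]]] := cP p.
have Utree : is_tree (fun s => T s /\ all (fun i => i < 2) s).
  move=> s u su [Tu bu]; split; first exact: Ttree su Tu.
  by move: su bu => /prefixP[v ->]; rewrite all_cat => /andP[].
exists (fun j => (t j == 1) && bin j), (exist _ _ Utree); split.
- exact: computes_subst (dP t).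
- move=> s; rewrite binP tT /=; congr nat_of_bool; apply/idP/asboolP.
    by case: asboolP.
  by move=> [Ts ->]; rewrite asboolT.
- by move=> s [].
- apply/seteqP; split=> z /=.
    move=> H n; split; last by have : body T z by [move=> k; case: (H k)]; rewrite bT.
    have [_ /allP] := H n.+1; apply.
    by apply/mapP; exists n; rewrite // mem_iota add0n ltnSn.
  move=> H k; have Tz : body T z by rewrite bT => n; have [] := H n.
  split; first exact: Tz.
  by apply/allP => _ /mapP[i _ ->]; case: (H i).
Qed.

(* [z = <chi, w>] where [chi] is the characteristic function of the tree and
   [w <code s, m>] a successor of [s] that is at least [m]. *)
Definition laver_check (p z : baire) (j : nat) : bool :=
  [&& z j.*2 <= 1,
      all (fun k => (z j.*2 != 1) || (z (code (mkseq (nth 0 (decode j)) k)).*2 == 1))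
        (iota 0 (size (decode j)).+1),
      z 0 == 1,
      (z (nfst j).*2 != 1) || (nsnd j <= z j.*2.+1) &&
        (z (code (rcons (decode (nfst j)) (z j.*2.+1))).*2 == 1) &
      (p j == 0) || (z (p j).-1.*2 == 0)].

(** The one index [j] is read as the code of a string, as a pair of a string code and a lower bound
    for a successor, and as a position in the enumeration [p]. *)
Lemma laver_checkW p z : (forall j, laver_check p z j) ->
  exists T, [/\ laver_tree T, charfun (fun n => z n.*2) T &
                forall s n, T s -> p n <> (code s).+1].
Proof.
move=> H; exists [set s | z (code s).*2 = 1]; split; first split.
- move=> s t st /eqP Tt; have /and5P[_ /all_iotaP/(_ (size s)) + _ _ _] := H (code t).
  rewrite CodeSeq.codeK Tt /= ltnS size_prefix // prefix_mkseq_nth //.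
  by move=> /(_ isT)/eqP.
- by have /and5P[_ _ /eqP] := H 0.
- move=> s Ts; apply/infinite_set_geq => m.
  have /and5P[_ _ _ + _] := H (npair (code s) m).
  rewrite nfstK nsndK CodeSeq.codeK Ts /= => /andP[mw /eqP].
  by exists (z (npair (code s) m).*2.+1).
- move=> s /=; have /and5P[+ _ _ _ _] := H (code s).
  by case: asboolP => /=; case: (z _) => [|[|k]].
- move=> s n /= Ts pn; have /and5P[_ _ _ _] := H n.
  by rewrite pn /= Ts.
Qed.

Lemma laver_check_ex p T : laver_tree T -> (forall s n, T s -> p n <> (code s).+1) ->
  exists z, forall j, laver_check p z j.
Proof.
move=> [Ttree T0 Tinf] Tp.
have /choice[w wP] (j : nat) : exists n, T (decode (nfst j)) ->
    nsnd j <= n /\ T (rcons (decode (nfst j)) n).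
  have [Tj|nTj] := pselect (T (decode (nfst j))); last by exists 0.
  have [n jn Tn] := (infinite_set_geq _).1 (Tinf _ Tj) (nsnd j).
  by exists n.
pose chi j : nat := `[< T (decode j) >].
exists (bpair chi w) => j; rewrite /laver_check.
have zl k : bpair chi w k.*2 = chi k by rewrite /bpair odd_double doubleK.
have zr k : bpair chi w k.*2.+1 = w k by rewrite /bpair /= odd_double uphalf_double.
rewrite (zl 0) !zr !zl; under eq_all do rewrite zl.
rewrite /chi !CodeSeq.codeK; apply/and5P; split.
- by case: asboolP.
- apply/all_iotaP => k kj; rewrite CodeSeq.codeK; case: asboolP => //= Tj.
  have pre : prefix (take k (decode j)) (decode j) := prefix_take _ _.
  have := prefix_mkseq_nth pre; rewrite size_takel // => ->.
  by rewrite asboolT //; exact: Ttree Tj.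
- by rewrite asboolT.
- case: asboolP => //= /wP[-> Tj] /=; by rewrite asboolT.
- case E: (p j) => [|k] //=; case: asboolP => // Tk; case: (Tp _ j Tk).
  by rewrite E CodeSeq.decodeK.
Qed.

(** * Finding Laver trees by choice on Baire space *)

Section WithLT.
Variables (LT : baire -> set (seq nat)) (hLT : laver_representation LT).

Lemma laver_LT q : laver_tree (LT q).
Proof. by have [[LTs _ _] _ _] := hLT; exact: LTs. Qed.

Lemma LT_surj T : laver_tree T -> exists q, LT q = T.
Proof. by have [[_ _ LTs] _ _] := hLT; move=> /LTs[q _ <-]; exists q. Qed.

Lemma computes_LT_charfun : exists c, forall q, exists2 t, computes c q t & charfun t (LT q).
Proof.
have [_ [F [c cF] FP] _] := hLT; exists c => q.
by have [t Fqt [_ tT]] := FP q _ erefl; exists t => //; exact: cF.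
Qed.

Lemma computes_charfun_LT : exists c, forall t T, laver_tree T -> charfun t T ->
  exists2 q, computes c t q & LT q = T.
Proof.
have [_ _ [F [c cF] FP]] := hLT; exists c => t T lT tT.
by have [q Ftq qT] := FP t T (conj lT tT); exists q => //; exact: cF.
Qed.

(** This licenses [reducible_wred] for reductions to [wFindL]. *)
Lemma solvable_wFindL : solvable (wFindL LT).
Proof.
move=> A; have [p pA] := closed_names_surj A; have AE : sval A = closed_of p := pA.
rewrite /= AE => /laver_dichotomy[T lT Tp].
have [q qT] := LT_surj lT; exists q.
by rewrite /= qT; apply/body_sub_closed_of.
Qed.

Lemma wFindL_C_baire : wred (wFindL LT) C_baire.
Proof.
have [e eP] : exists e, forall p, exists (t : baire) (T : tree),
    [/\ computes e p t, tree_names t T &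
        body (sval T) = [set z | forall n, laver_check p z n]].
  apply: pi01_tree.
  have := urec_oracle (fun x : baire * baire => bpair x.1 x.2).
  set o := fun x : baire * baire => bpair x.1 x.2 => ho.
  have hp : urec o (fun x => x.1) by exact: urec_bpair_l ho.
  have hz : urec o (fun x => x.2) by exact: urec_bpair_r ho.
  rewrite /laver_check; urec_tac.
  by apply: urec_rcons; urec_tac.
have [pr prP] := computes_bpair_r.
have [c cP] := computes_charfun_LT.
have [ev evP] := computes_bpair_l.
exists e, (subst (subst pr ev) c) => p A pA Adom.
have [t [T [et tT bT]]] := eP p.
have AE : sval A = closed_of p := pA.
exists t, T; split=> // [|_ z -> ].
  move: Adom; rewrite /= AE => /laver_dichotomy[L lL /(laver_check_ex lL)[z zP]].
  by exists z; rewrite bT.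
rewrite /= bT => /laver_checkW[L [lL zL Lp]].
have [q cq qL] := cP _ _ lL zL.
exists q, q; split=> //; last by rewrite /= AE qL; apply/body_sub_closed_of.
apply: computes_subst cq.
have [u [v zE]] := bpair_surj z; apply: (computes_subst (prP _ _)).
rewrite zE; suff -> : (fun n => bpair u v n.*2) = u by [].
by apply/funext => n; rewrite /bpair odd_double doubleK.
Qed.

Lemma computes_laver_branch : exists c, forall t T, laver_tree T -> charfun t T ->
  exists2 x, computes c t x & body T x.
Proof.
pose I := {t : baire | exists2 T, laver_tree T & charfun t T}.
pose o (i : I) := sval i; have ho := urec_oracle o.
(* Off the tree every [m] is accepted, which keeps the search for a successor total. *)
pose ext i j m := (o i j == 0) || (o i (code (rcons (decode j) m)) == 1).
have ext_ex i j : exists m, ext i j m.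
  have [T [_ _ Tinf] tT] := svalP i.
  rewrite /ext -{1}(CodeSeq.decodeK j) /o !tT; case: asboolP => Tj; last by exists 0.
  have [m _ Tm] := (infinite_set_geq _).1 (Tinf _ Tj) 0.
  by exists m; rewrite tT /= asboolT.
pose nxt i j := ex_minn (ext_ex i j).
have hnxt : urec o nxt.
  apply: (@urec_mu _ _ (fun i j m => ~~ ext i j m)).
  - rewrite /ext; urec_tac.
    by apply: urec_rcons; urec_tac.
  - by move=> i n; rewrite /nxt; case: ex_minnP => m ->.
  - move=> i n j; rewrite /nxt; case: ex_minnP => m _ mmin jm.
    by case E: (ext i n j) => //; have := mmin j E; rewrite leqNgt jm.
have [c cP] : urec o (fun i => branch [::] (fun s => nxt i (code s))).
  apply: (@urec_ext _ _ (fun i n => nxt i (nat_rect (fun=> nat) 0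
      (fun _ r => code (rcons (decode r) (nxt i r))) n))).
    move=> i n; rewrite /branch subn0 /=; congr nxt.
    by elim: n => //= n ->; rewrite CodeSeq.codeK.
  apply: (urec_comp hnxt); urec_tac.
  by apply: urec_rcons; urec_tac.
exists c => t T lT tT; pose i : I := exist _ t (ex_intro2 _ _ T lT tT).
exists (branch [::] (fun s => nxt i (code s))); first exact: cP i.
have [Ttree T0 _] := lT.
apply: body_branch => // s Ts; rewrite /nxt; case: ex_minnP => m + _.
by rewrite /ext /o /= CodeSeq.codeK !tT asboolT //=; case: asboolP.
Qed.

End WithLT.

(** * Paths of finitely branching trees *)

(* Whether the part of [T] below [x] has arbitrarily long strings agreeing with [u]. *)
Definition extendible (T : set (seq nat)) (x : baire) (u : seq nat) : Prop :=
  forall n, exists s, [/\ T s, size s = n, (forall i, i < n -> nth 0 s i <= x i) &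
    forall i, i < n -> i < size u -> nth 0 s i = nth 0 u i].

(* Koenig's lemma: there are only [(x (size u)).+1] candidates for [j]. *)
Lemma extendible_rcons T x u : is_tree T -> extendible T x u ->
  exists j, extendible T x (rcons u j).
Proof.
move=> Ttree Eu; apply: contrapT => nE.
have /choice[N NP] j : exists n, forall s, T s -> size s = n ->
    (forall i, i < n -> nth 0 s i <= x i) ->
    ~ (forall i, i < n -> i < size (rcons u j) -> nth 0 s i = nth 0 (rcons u j) i).
  apply: contrapT => H; apply: nE; exists j => n; apply: contrapT => nn.
  by apply: H; exists n => s Ts sn sx su; apply: nn; exists s.
(* A length beyond [u] and at least every length [N j] at which a candidate fails. A string of
   length [M] then refutes the failure of the candidate that is its own entry at [size u]. *)
pose M := maxn (size u).+1 (\max_(j < (x (size u)).+1) N j).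
have [s [Ts sM sx su]] := Eu M.
have uM : size u < M by exact: leq_maxl.
have xj : nth 0 s (size u) < (x (size u)).+1 by exact: sx.
pose j := Ordinal xj; have NM : N j <= M.
  apply: leq_trans (leq_maxr _ _).
  exact: (leq_bigmax (F := fun j : 'I__ => N j) j).
apply: (NP j (take (N j) s)).
- by apply: Ttree Ts; exact: prefix_take.
- by rewrite size_takel // sM.
- by move=> i iN; rewrite nth_take // sx // (leq_trans iN).
- move=> i iN; rewrite size_rcons ltnS leq_eqVlt nth_take // nth_rcons => /predU1P[->|iu].
    by rewrite ltnn eqxx.
  by rewrite iu su // (leq_trans iN).
Qed.

Definition leftmost T x (g : baire) : Prop := forall n,
  extendible T x (rcons (mkseq g n) (g n)) /\
  forall j, j < g n -> ~ extendible T x (rcons (mkseq g n) j).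

Lemma leftmost_ex T x : is_tree T -> extendible T x [::] -> exists g, leftmost T x g.
Proof.
move=> Ttree E0.
have /choice[f fP] u : exists j, extendible T x u -> extendible T x (rcons u j) /\
    forall i, i < j -> ~ extendible T x (rcons u i).
  have [Eu|nEu] := pselect (extendible T x u); last by exists 0.
  have [j Ej] := extendible_rcons Ttree Eu.
  have exj : exists j, `[< extendible T x (rcons u j) >] by exists j; exact/asboolP.
  exists (ex_minn exj) => _; case: ex_minnP => m /asboolP Em mmin; split=> // i im.
  by move/asboolP/mmin; rewrite leqNgt im.
have Est k : extendible T x (mkseq (branch [::] f) k).
  rewrite -[k]add0n (mkseq_branch [::]).
  by elim: k => //= k /fP[].
by exists (branch [::] f) => n; rewrite branch_ge //; exact: fP.
Qed.

Lemma leftmost_body T x g : leftmost T x g -> body T g /\ forall n, g n <= x n.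
Proof.
move=> gP; have E n : extendible T x (mkseq g n.+1) by rewrite mkseqS; case: (gP n).
split=> n.
  have [s [Ts sn _ sg]] := E n n; suff <- : s = mkseq g n by [].
  apply: (@eq_from_nth _ 0); rewrite ?size_mkseq // sn => i ilt.
  by rewrite sg ?size_mkseq ?nth_mkseq // ltnW.
have [s [Ts sn sx sg]] := E n n.+1; have := sx n (ltnSn n).
by rewrite sg ?size_mkseq ?nth_mkseq.
Qed.

Lemma body_extendible T x g : body T g -> (forall n, g n <= x n) ->
  extendible T x [::].
Proof.
move=> Tg gx n; exists (mkseq g n); split=> //; first exact: size_mkseq.
by move=> i ilt; rewrite nth_mkseq.
Qed.

(** * Choice on Baire space from Laver trees *)

Lemma bpair_inj p q p' q' : bpair p q = bpair p' q' -> p = p' /\ q = q'.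
Proof.
move=> e; split; apply/funext => n.
  by have := congr1 (fun z => z n.*2) e; rewrite /bpair odd_double doubleK.
have := congr1 (fun z => z n.*2.+1) e.
by rewrite /bpair /= odd_double /= uphalf_double.
Qed.

(** Turns a pointwise bound on strings into a bound for a search through codes. *)
Lemma leq_code (s t : seq nat) : size s = size t ->
  (forall i, i < size s -> nth 0 s i <= nth 0 t i) -> code s <= code t.
Proof.
elim: s t => [|a s IHs] [|b t] //= [st] le_st.
apply: leq_mul; first by rewrite leq_pexp2l //; exact: (le_st 0).
by rewrite ltnS leq_double; apply: IHs => // i ilt; exact: (le_st i.+1).
Qed.

(* The pointwise bound on [decode k] makes [k <= j], see [leq_code]. *)
Definition unbounded_enum (p : baire) : baire := fun j =>
  if has (fun k => [&& p k == 1, size (decode k) == size (decode j) &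
            all (fun i => nth 0 (decode k) i <= nth 0 (decode j) i)
                (iota 0 (size (decode j)))]) (iota 0 j.+1)
  then 0 else j.+1.

(** The output [j.+1] removes the string of code [j]; this happens when no string of [T] of the same
    length lies pointwise below it. With [[::]] as the string to agree with, [extendible] says that
    no prefix of [x] is removed. *)
Lemma closed_of_unbounded_enum p T : charfun p T ->
  closed_of (unbounded_enum p) = [set x | extendible T x [::]].
Proof.
move=> pT; apply/seteqP; split=> [x px n|x Ex j k].
  have := px (code (mkseq x n)) n; rewrite /unbounded_enum; case: ifP => // + _.
  rewrite CodeSeq.codeK size_mkseq => /has_iotaP[k _ /and3P[pk /eqP sk /all_iotaP le_k]].
  exists (decode k); split=> //.
    by move: pk; rewrite -{1}(CodeSeq.decodeK k) pT; case: asboolP.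
  by move=> i ilt; rewrite -(nth_mkseq 0 x ilt) le_k.
rewrite /unbounded_enum; case: ifP => // /negP nh [jE]; apply: nh.
have [s [Ts sk sx _]] := Ex k; rewrite jE CodeSeq.codeK size_mkseq.
have sj i : i < k -> nth 0 s i <= nth 0 (mkseq x k) i.
  by move=> ilt; rewrite nth_mkseq // sx.
apply/has_iotaP; exists (code s).
  by rewrite ltnS leq_code ?size_mkseq // sk.
rewrite pT asboolT //= CodeSeq.codeK sk eqxx /=.
exact/all_iotaP.
Qed.

(** The output repeats a name of the tree for the benefit of the problem composed after it. *)
Definition domination : problem tree_space baire_space :=
  Problem tree_space baire_space
    (fun T : tree_space => body (sval T) !=set0)
    (fun T => [set y | exists p x, [/\ tree_names p T, y = bpair p x &
                                     extendible (sval T) x [::]]]).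

Definition bounded_path : problem baire_space baire_space :=
  Problem baire_space baire_space
    [set y : baire | exists p x (T : tree), [/\ tree_names p T, y = bpair p x &
       extendible (sval T) x [::]]]
    (fun y => [set g : baire | exists p x (T : tree),
       [/\ tree_names p T, y = bpair p x & body (sval T) g]]).

Section Hard.
Variables (LT : baire -> set (seq nat)) (hLT : laver_representation LT).

Lemma unbounded_enum_instance (p : baire) (T : tree) : tree_names p T ->
    body (sval T) !=set0 ->
  exists A : closed_space, [/\ closed_names (unbounded_enum p) A,
    dom (wFindL LT) A & sval A = [set x | extendible (sval T) x [::]]].
Proof.
move=> pT [g Tg]; exists (exist _ _ (@closed_closed_of (unbounded_enum p))).
split=> //=; last exact: closed_of_unbounded_enum.
move=> L lL; have L0 : L [::] by case: lL.
have [x [Lx _ gx]] := laver_branch g lL L0; exists x; split=> //.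
rewrite (closed_of_unbounded_enum pT).
by apply: (body_extendible Tg) => n; exact: gx.
Qed.

Lemma computes_unbounded_enum : exists c, forall p, computes c p (unbounded_enum p).
Proof.
have hp := urec_oracle (fun p : baire => p).
suff [c cP] : urec (fun p : baire => p) unbounded_enum by exists c.
by rewrite /unbounded_enum; urec_tac.
Qed.

Lemma computes_LT_branch : exists c, forall q, exists2 x, computes c q x & body (LT q) x.
Proof.
have [c cP] := computes_LT_charfun hLT; have [d dP] := computes_laver_branch.
exists (subst c d) => q; have [t ct tT] := cP q.
have [x dx Tx] := dP t _ (laver_LT hLT q) tT.
by exists x => //; exact: computes_subst dx.
Qed.

Lemma domination_wFindL : wred domination (wFindL LT).
Proof.
have [c cP] := computes_unbounded_enum; have [d dP] := computes_LT_branch.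
have [pl plP] := computes_bpair_l; have [pr prP] := computes_bpair_r.
have [b bP] := computes_bpair pl (subst pr d).
exists c, b => p T pT Tdom; have [A [pA Adom AE]] := unbounded_enum_instance pT Tdom.
exists (unbounded_enum p), A; split=> // _ q -> /=; rewrite AE => qA.
have [x dx qx] := dP q; exists (bpair p x), (bpair p x); split=> //.
  by apply: bP => //; exact: computes_subst dx.
by exists p, x; split=> //; exact: qA.
Qed.

End Hard.

(* [z] is a 0-1 sequence describing the graph of a function; the search range keeps
   the decoding total, whatever [z] is. *)
Definition unary_decode (x z : baire) : baire :=
  fun n => find (fun k => z (npair n k) != 0) (iota 0 (x n).+1).

(** Every binary sequence decodes to some function, so it can be tested level by level whether the
    decoded function stays in the tree; this is a Pi^0_1 condition on Cantor space. *)
Lemma bounded_path_C_cantor : wred bounded_path C_cantor.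
Proof.
pose J : Type := baire * baire; pose o (i : J) := bpair i.1 i.2.
have hy : urec o (fun i => i.1) := urec_bpair_l (urec_oracle o).
have hz : urec o (fun i => i.2) := urec_bpair_r (urec_oracle o).
pose path (y z : baire) := unary_decode (fun n => y n.*2.+1) z.
have hg : urec o (fun i => path i.1 i.2) by rewrite /path /unary_decode; urec_tac.
pose b (y z : baire) n := y (code (mkseq (path y z) n)).*2 == 1.
have /pi01_binary_tree[c cP] : urec o (fun i n => b i.1 i.2 n) by rewrite /b; urec_tac.
have [d dP] := hg; exists c, d => _ y -> [p [x [T [pT yE ET]]]].
have yl k : y k.*2 = p k by rewrite yE /bpair odd_double doubleK.
have yr k : y k.*2.+1 = x k by rewrite yE /bpair /= odd_double uphalf_double.
have bE z n : b y z n = `[< sval T (mkseq (path y z) n) >].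
  by rewrite /b yl pT; case: asboolP.
have [t [S [ct tS Sbin bS]]] := cP y.
exists t, S; split=> //.
  split=> //; have [g gP] := leftmost_ex (svalP T) ET.
  have [Tg gx] := leftmost_body gP.
  pose z : baire := fun m => nsnd m == g (nfst m).
  exists z; rewrite bS => n; split; first by rewrite /z; case: (_ == _).
  rewrite bE; apply/asboolP; suff -> : path y z = g by exact: Tg.
  apply/funext => m; rewrite /path /unary_decode yr.
  apply: find_iota_eq; rewrite ?ltnS ?gx //= /z ?nsndK ?nfstK ?eqxx // => j jg.
  by rewrite nsndK nfstK (ltn_eqF jg).
(* A position with no mark in range decodes to one more than the bound. The answer is still correct,
   since [bounded_path] asks for a path of [T] and not for one below [x]. *)
move=> _ z -> /=; rewrite bS => zP.
exists (path y z), (path y z); split=> //; first exact: (dP (y, z)).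
exists p, x, T; split=> // n; apply/asboolP; rewrite -bE.
by case: (zP n).
Qed.

Lemma compose_domination_sol (T : tree) g :
  sol (compose bounded_path domination) T g -> body (sval T) g.
Proof.
move=> [_ [p [x [pT -> _]]] [p' [x' [T' [pT' /bpair_inj[e _] Tg]]]]].
by subst p'; rewrite (tree_names_fun pT pT').
Qed.

Lemma C_baire_compose : wred C_baire (compose bounded_path domination).
Proof.
have [i iP] := computes_id; have [pr prP] := computes_bpair_r.
exists i, pr => p T pT Tdom; exists p, T; split=> //.
  by split=> // _ [q [x [qT -> Ex]]]; exists q, x, T.
move=> _ g -> gT; exists g, g; split=> //; exact: compose_domination_sol gT.
Qed.

(** The fact [bound] serves twice: for maximality, and, applied to [bounded_path] after
    [domination], for one half of the equivalence with this composition. *)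
Lemma C_baire_comp_product LT (hLT : laver_representation LT) :
  is_comp_product C_cantor (wFindL LT) C_baire.
Proof.
have sol_w := solvable_wFindL hLT; have w_C := wFindL_C_baire hLT.
have bound (A B C : repspace) (f0 : problem B C) (g0 : problem A B) :
    f0 <=W C_cantor -> g0 <=W wFindL LT -> compose f0 g0 <=W C_baire.
  move=> /(reducible_wred solvable_C_cantor) f0C /(reducible_wred sol_w) g0w.
  apply/wred_reducible/wred_compose_C_baire; last exact: wred_trans g0w w_C.
  exact: wred_trans f0C C_cantor_C_baire.
split=> //; exists tree_space, baire_space, baire_space, bounded_path, domination.
have fC := wred_reducible bounded_path_C_cantor.
have gw := wred_reducible (domination_wFindL hLT).
split=> //; split; last exact: bound.
exact/wred_reducible/C_baire_compose.
Qed.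

(** * Arithmetical reductions *)

Local Notation total_urec := (urec (fun p : baire => p)).

Lemma arith_ext (R S : baire -> nat -> Prop) :
  (forall p n, R p n <-> S p n) -> arith_rel R -> arith_rel S.
Proof.
move=> RS; suff -> : R = S by [].
by apply/funext => p; apply/funext => n; apply/propext.
Qed.

Lemma arith_comp (R : baire -> nat -> Prop) (f : baire -> nat -> nat) :
  arith_rel R -> total_urec f -> arith_rel (fun p n => R p (f p n)).
Proof.
move=> aR; elim: aR f => {R} [c|R _ IH|R S _ IHR _ IHS|R _ IH] f hf.
- have [d dP] := hf; apply: arith_ext (arith_semirec (PComp c d)) => p n.
  split=> -[v]; last by exists v; exact: eval_comp (dP p n) _.
  by move=> /eval_inv[m /(eval_det (dP p n))<-]; exists v.
- exact/arith_not/IH.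
- by apply: arith_and; [exact: IHR|exact: IHS].
- have := IH (fun p x => npair (f p (nfst x)) (nsnd x)).
  have /[swap] /[apply] : total_urec (fun p x => npair (f p (nfst x)) (nsnd x)) by urec_tac.
  move=> /arith_ex; apply: arith_ext => p n.
  by split=> -[k Rk]; exists k; rewrite !(nfstK, nsndK) in Rk *.
Qed.

(** Carries a relation on a tree and a bound over to the tree and a Laver tree from which the bound
    is computed. *)
Lemma arith_subst (R : baire -> nat -> Prop) d : arith_rel R ->
  exists2 S, arith_rel S & forall o x, computes d o x -> forall n, S o n <-> R x n.
Proof.
elim=> {R} [c|R _ [S aS SR]|R R' _ [S aS SR] _ [S' aS' SR']|R _ [S aS SR]].
- exists (fun p n => exists v, eval p (subst d c) n v); first exact: arith_semirec.
  by move=> o x dox n; split=> -[v] /(eval_subst _ _ _ dox); exists v.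
- exists (fun p n => ~ S p n); first exact: arith_not.
  by move=> o x /SR H n; split=> + /H.
- exists (fun p n => S p n /\ S' p n); first exact: arith_and.
  by move=> o x dox n; split=> -[/(SR _ _ dox) ? /(SR' _ _ dox)].
- exists (fun p n => exists k, S p (npair n k)); first exact: arith_ex.
  by move=> o x dox n; split=> -[k /(SR _ _ dox)]; exists k.
Qed.

(** The tested value ignores the search variable, so the search halts at [0] or never. *)
Lemma eval_mu_dec d p (b : nat -> bool) n :
  computes d p (fun x => ~~ b (nfst x)) -> (exists v, eval p (PMu d) n v) <-> b n.
Proof.
move=> dP; split=> [[v /eval_inv[/(eval_det (dP _))]]|bn].
  by rewrite nfstK; case: (b n).
exists 0; apply: eval_mu => //; have := dP (npair n 0).
by rewrite nfstK bn.
Qed.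

Lemma arith_dec (b : baire -> nat -> bool) :
  total_urec (fun p n => b p n) -> arith_rel (fun p n => b p n).
Proof.
move=> hb; have [d dP] : total_urec (fun p x => ~~ b p (nfst x)).
  by apply: urec_not; apply: (urec_comp hb); urec_tac.
by apply: arith_ext (arith_semirec (PMu d)) => p n; exact: eval_mu_dec (dP p).
Qed.

Lemma arith_exP (R : baire -> nat -> nat -> Prop) :
  arith_rel (fun p x => R p (nfst x) (nsnd x)) -> arith_rel (fun p n => exists k, R p n k).
Proof.
move=> /arith_ex; apply: arith_ext => p n.
by split=> -[k]; rewrite ?nfstK ?nsndK => Rk; exists k; rewrite ?nfstK ?nsndK.
Qed.

Lemma arith_allP (R : baire -> nat -> nat -> Prop) :
  arith_rel (fun p x => R p (nfst x) (nsnd x)) -> arith_rel (fun p n => forall k, R p n k).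
Proof.
move=> /arith_not/(@arith_exP (fun p n k => ~ R p n k))/arith_not.
apply: arith_ext => p n; split=> [H k|H [k]]; last by apply.
by apply: contrapT => nR; apply: H; exists k.
Qed.

Lemma arith_impl (R S : baire -> nat -> Prop) :
  arith_rel R -> arith_rel S -> arith_rel (fun p n => R p n -> S p n).
Proof.
move=> aR /arith_not/(arith_and aR)/arith_not; apply: arith_ext => p n.
split=> [H Rn|H [/H]//]; apply: contrapT => nS; exact: H.
Qed.

Lemma computable_arithmetical F : computable F -> arithmetical F.
Proof.
move=> [c cF]; pose I := {x : baire * baire | F x.1 x.2}.
pose o (i : I) := (sval i).1; pose q (i : I) := (sval i).2.
have hq : urec o q by exists c => i; exact: cF (svalP i).
have [d dP] : urec o (fun i x => ~~ (q i (nfst (nfst x)) == nsnd (nfst x))) by urec_tac.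
exists (fun p n => exists v, eval p (PMu d) n v); first exact: arith_semirec.
move=> p r Fpr n m; pose i : I := exist _ (p, r) Fpr.
have := @eval_mu_dec d p (fun x => r (nfst x) == nsnd x) (npair n m) (dP i).
by rewrite nfstK nsndK => ->; split=> /eqP.
Qed.

Lemma reducible_arithmetical (X Y Z W : repspace) (f : problem X Y) (g : problem Z W) :
  f <=W g -> f <=aW g.
Proof.
move=> [phi [psi [cphi cpsi H]]]; exists phi, psi.
by split=> //; exact: computable_arithmetical.
Qed.

(** * Functions with arithmetical graph, and the leftmost path *)

Lemma graph_rel_fun (R : baire -> nat -> Prop) (p q r : baire) :
  (forall n m, R p (npair n m) <-> q n = m) ->
  (forall n m, R p (npair n m) <-> r n = m) -> q = r.
Proof. by move=> Rq Rr; apply/funext => n; apply/Rq/Rr. Qed.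

Definition rel_fun (R : baire -> nat -> Prop) : pfun := PFun (@graph_rel_fun R).

Lemma arithmetical_rel_fun R : arith_rel R -> arithmetical (rel_fun R).
Proof. by exists R. Qed.

(** Even places of [y] hold the tree, odd places the bound. Strings of length [n] below the bound
    have codes at most that of its own prefix, so the search is finite and one number quantifier
    remains. *)
Definition extendible_rel (y : baire) (j : nat) : Prop := forall n,
  has (fun k => [&& y k.*2 == 1, size (decode k) == n,
      all (fun i => nth 0 (decode k) i <= y i.*2.+1) (iota 0 n) &
      all (fun i => (size (decode j) <= i) ||
                    (nth 0 (decode k) i == nth 0 (decode j) i)) (iota 0 n)])
    (iota 0 (code (mkseq (fun i => y i.*2.+1) n)).+1).

Lemma extendible_relP p x T u : charfun p T ->
  extendible_rel (bpair p x) (code u) <-> extendible T x u.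
Proof.
move=> pT.
have yl k : bpair p x k.*2 = p k by rewrite /bpair odd_double doubleK.
have yr k : bpair p x k.*2.+1 = x k by rewrite /bpair /= odd_double uphalf_double.
split=> H n.
  have /has_iotaP[k _ /and4P[]] := H n.
  rewrite yl -{1}(CodeSeq.decodeK k) pT => Tk /eqP sk /all_iotaP kx /all_iotaP ku.
  exists (decode k); split=> // [|i /kx|i ilt iu]; first by move: Tk; case: asboolP.
    by rewrite yr.
  by have := ku i ilt; rewrite CodeSeq.codeK leqNgt iu => /eqP.
have [s [Ts sn sx su]] := H n; apply/has_iotaP; exists (code s).
  rewrite ltnS leq_code ?size_mkseq // => i ilt.
  by rewrite nth_mkseq ?yr ?sx -?sn.
rewrite yl pT asboolT //= !CodeSeq.codeK sn eqxx /=; apply/andP; split.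
  by apply/all_iotaP => i ilt; rewrite yr sx.
apply/all_iotaP => i ilt; case: leqP => //= iu.
by rewrite su.
Qed.

Lemma arith_extendible_rel : arith_rel extendible_rel.
Proof.
apply: arith_allP; apply: arith_dec.
have hy := urec_oracle (fun y : baire => y).
by urec_tac.
Qed.

Definition least_rel (y : baire) (a : nat) : Prop :=
  extendible_rel y (code (rcons (decode (nfst a)) (nsnd a))) /\
  forall j, j < nsnd a -> ~ extendible_rel y (code (rcons (decode (nfst a)) j)).

Lemma arith_least_rel : arith_rel least_rel.
Proof.
apply: arith_and.
  by apply: (arith_comp arith_extendible_rel); apply: urec_rcons; urec_tac.
apply: arith_allP; apply: arith_impl.
  by apply: arith_dec; urec_tac.
apply: arith_not; apply: (arith_comp arith_extendible_rel).
by apply: urec_rcons; urec_tac.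
Qed.

(** Each entry of the leftmost path depends on the earlier ones through an arithmetical condition.
    Quantifying over a code [s] of all earlier entries replaces this recursion by a single
    arithmetical formula. *)
Definition leftmost_rel (y : baire) (a : nat) : Prop := exists s,
  size (decode s) == nfst a /\ least_rel y (npair s (nsnd a)) /\
  forall i, i < nfst a -> least_rel y
    (npair (code (mkseq (nth 0 (decode s)) i)) (nth 0 (decode s) i)).

Lemma arith_leftmost_rel : arith_rel leftmost_rel.
Proof.
apply: arith_exP; apply: arith_and; first by apply: arith_dec; urec_tac.
apply: arith_and; first by apply: (arith_comp arith_least_rel); urec_tac.
apply: arith_allP; apply: arith_impl; first by apply: arith_dec; urec_tac.
by apply: (arith_comp arith_least_rel); urec_tac.
Qed.

Lemma leftmost_relP p x T g : charfun p T -> leftmost T x g ->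
  forall n m, leftmost_rel (bpair p x) (npair n m) <-> g n = m.
Proof.
move=> pT gP n m.
have leastP i j : least_rel (bpair p x) (npair (code (mkseq g i)) j) <-> j = g i.
  rewrite /least_rel nfstK nsndK CodeSeq.codeK.
  have [Eg ng] := gP i; split=> [[Ej nj]|->].
    case: (ltngtP j (g i)) => // [/ng[]|/nj[]]; exact/(extendible_relP _ _ pT).
  by split=> [|l lg]; rewrite (extendible_relP _ _ pT) //; exact: ng.
split=> [[s]|<-].
  rewrite nfstK nsndK => -[/eqP sn [sm si]].
  (* The guessed entries are determined one after the other, hence [s] codes a prefix of [g]. *)
  have sg i : i <= n -> mkseq (nth 0 (decode s)) i = mkseq g i.
    elim: i => // i IHi ilt; rewrite !mkseqS IHi 1?ltnW //; congr rcons.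
    by apply/leastP; rewrite -IHi 1?ltnW //; exact: si.
  apply/esym/leastP; rewrite -(sg n (leqnn n)) -sn mkseq_nth CodeSeq.decodeK.
  exact: sm.
exists (code (mkseq g n)); rewrite !nfstK !nsndK CodeSeq.codeK size_mkseq eqxx.
split=> //; split=> [|i ilt]; first exact/leastP.
rewrite nth_mkseq //; suff -> : mkseq (nth 0 (mkseq g n)) i = mkseq g i by apply/leastP.
apply/eq_in_map => j; rewrite mem_iota add0n => /= ji.
by rewrite nth_mkseq // (ltn_trans ji).
Qed.

Lemma C_baire_arith_wFindL LT (hLT : laver_representation LT) : C_baire <=aW wFindL LT.
Proof.
have [c cP] := computes_unbounded_enum; have [d dP] := computes_LT_branch hLT.
have [pl plP] := computes_bpair_l; have [pr prP] := computes_bpair_r.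
have [b bP] := computes_bpair pl (subst pr d).
have [R aR RP] := arith_subst b arith_leftmost_rel.
exists (prog_fun c), (rel_fun R); split.
- exact/computable_arithmetical/computable_prog_fun.
- exact: arithmetical_rel_fun.
move=> G Gw p T pT Tdom; have [A [pA Adom AE]] := unbounded_enum_instance LT pT Tdom.
have [q [_ [Gq <- /=]]] := Gw _ _ pA Adom; rewrite AE => qA.
have [x dx qx] := dP q; have [g gP] := leftmost_ex (svalP T) (qA x qx).
exists g, g; split=> //; last by have [] := leftmost_body gP.
exists (unbounded_enum p), q; split=> //= n m.
rewrite (RP _ (bpair p x)); last by apply: bP => //; exact: computes_subst dx.
exact: leftmost_relP.
Qed.

Theorem proposition5p5 (LT : (nat -> nat) -> set (seq nat))
    (hLT : laver_representation LT) :
  (exists (S T : repspace) (h : problem S T),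
      is_comp_product C_cantor (wFindL LT) h /\ h =W C_baire) /\
  wFindL LT =aW C_baire.
Proof.
split.
  exists tree_space, baire_space, C_baire; split; first exact: C_baire_comp_product.
  by split; exact/wred_reducible/wred_refl.
split; last exact: C_baire_arith_wFindL.
exact/reducible_arithmetical/wred_reducible/wFindL_C_baire.
Qed.
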